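(* Let $m\ge 2$ be an integer, $a>0$, $\theta>1$, $\sigma>1$ real numbers, and let $Q$, $q$, $b_1,\dots,b_{m-1}$, $h$ be as in the context; in particular $$(-1)^m Q(r,t_0,\ldots,t_{m-1})\ \ge\ q(r)h(t_0)-\sum_{i=1}^{m-1}b_i(r)|t_i|$$ whenever $r\ge a$, $t_0>0$ and $(-1)^i t_i\ge 0$ for $i=1,\ldots,m-1$. Let $g$, $f$ be the functions defined in the context. Suppose that $$\int_0^1 g^{-1/m}(t)\,t^{1/m-1}\,dt<\infty,\qquad \int_a^\infty \xi^{m-1} f(\xi)\,d\xi=\infty,$$ and, moreover, $$\limsup_{r\to\infty}\frac{r^m f(r)}{\int_a^r\xi^{m-1}f(\xi)\,d\xi}<\infty .$$ Then any non-trivial solution $w$ of the problem $$w^{(m)}=Q(r,w,\ldots,w^{(m-1)}),\quad r\ge a,\qquad (-1)^i w^{(i)}(r)\ge 0,\quad r\ge a,\ i=0,\ldots,m-1,$$ is singular of the first kind, i.e. $w$ vanishes identically in a neighborhood of infinity.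
   Context: Setting. $Q:[a,\infty)\times\mathbb R^m\to\mathbb R$ belongs to the Caratheodory class $K_{loc}([a,\infty)\times\mathbb R^m)$: $Q(\cdot,t)$ is measurable for every $t\in\mathbb R^m$, $Q(r,\cdot)$ is continuous for almost every $r$, and for every $\rho>0$ the function $r\mapsto\sup_{|t|\le\rho}|Q(r,t)|$ is integrable on every compact subinterval of $[a,\infty)$. The functions $q:[a,\infty)\to[0,\infty)$ and $b_i:[a,\infty)\to[0,\infty)$, $i=1,\ldots,m-1$, belong to $L_{\infty,loc}([a,\infty))$ (measurable and essentially bounded on compact subintervals), and $h:(0,\infty)\to(0,\infty)$ is continuous. Solutions. A function $w:[a,\infty)\to\mathbb R$ is a solution of the problem if $w^{(i)}$, $i=0,\ldots,m-1$, are locally absolutely continuous on $[a,\infty)$, the equation holds for almost all $r\in[a,\infty)$, and the sign conditions hold for all $r\in[a,\infty)$. A solution is non-trivial if it is not identically zero on $[a,\infty)$. A non-trivial solution is singular of the first kind if it vanishes in a neighborhood of infinity; otherwise it is called regular. Notation. For the fixed (arbitrarily chosen) real numbers $\theta>1$, $\sigma>1$: $$g(t)=\inf_{(t/\theta,\,\theta t)}h,\quad t\in(0,\infty),$$ $$f(r)=\frac{q(r)}{1+\sum_{i=1}^{m-1}r^{m-i}\,\operatorname{ess\,sup}_{(r/\sigma,\,r\sigma)\cap[a,\infty)}b_i},\quad r\in[a,\infty).$$ *)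

(* Defs.v *)
From HB Require Import structures.
From mathcomp Require Import all_boot all_order all_algebra.
From mathcomp Require Import all_classical all_reals all_analysis.
From mathcomp Require Import ess_sup_inf.
Import Order.TTheory GRing.Theory Num.Theory.
Import numFieldNormedType.Exports.

Set Implicit Arguments.
Unset Strict Implicit.
Unset Printing Implicit Defensive.

Local Open Scope classical_set_scope.
Local Open Scope ring_scope.

(* The real line with the sigma-algebra of Lebesgue measurable sets (the
   default structure on [R] carries only the Borel sets), and the Lebesgue
   measure on it. *)
Notation lebesgueType R := (caratheodory_type ((@wlength R idfun)^*)%mu).
Notation leb R := (@completed_lebesgue_measure R).

Section Defs.
Context {R : realType}.
Implicit Types (a r c d : R) (f w q h : R -> R) (b : nat -> R -> R) (m : nat).

Definition lmeasurable_fun (D : set R) f :=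
  measurable_fun (D : set (lebesgueType R)) (f : lebesgueType R -> R).

(* The value -oo outside [D] makes the points outside [D] irrelevant. *)
Definition ess_sup_on (D : set R) f : \bar R :=
  ess_sup (leb R) (patch (fun=> -oo%E) D (fun x => (f x)%:E)).

Definition Linfty_loc a f :=
  lmeasurable_fun `[a, +oo[ f /\
  forall c d, a <= c -> (ess_sup_on `[c, d] (fun x => `|f x|%R) < +oo)%E.

Definition enorm m (t : 'rV[R]_m) : R := Num.sqrt (\sum_(i < m) t 0 i ^+ 2).

Definition Caratheodory_loc a m (Q : R -> 'rV[R]_m -> R) :=
  [/\ forall t, lmeasurable_fun `[a, +oo[ (fun r => Q r t),
      {ae leb R, forall r, a <= r -> continuous (Q r)} &
      forall rho : R, 0 < rho -> forall c d, a <= c ->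
        (leb R).-integrable (`[c, d] : set (lebesgueType R))
          (fun r => ereal_sup [set `|Q r t|%:E | t in [set t | enorm t <= rho]])].

(* Derivatives relative to a set [A]: one-sided at an endpoint of [A], so that
   only the values of the function on [A] matter. *)
Definition diff_quot f (x y : R) : R := (f y - f x) / (y - x).

Definition derivable_on (A : set R) f (x : R) :=
  cvg (diff_quot f x y @[y --> within A x^']).

Definition derive_on (A : set R) f (x : R) : R :=
  lim (diff_quot f x y @[y --> within A x^']).

Definition deriven_on (A : set R) (n : nat) f : R -> R :=
  iter n (derive_on A) f.

Definition abs_continuous c d f :=
  forall eps : R, 0 < eps -> exists2 delta : R, 0 < delta &
  forall (n : nat) (x y : 'I_n -> R),
    (forall i, [/\ c <= x i, x i <= y i & y i <= d]) ->
    trivIset setT (fun i => `]x i, y i[%classic) ->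
    \sum_(i < n) (y i - x i) < delta ->
    \sum_(i < n) `|f (y i) - f (x i)| < eps.

Definition loc_abs_continuous a f :=
  forall c d, a <= c -> c <= d -> abs_continuous c d f.

Definition jet a m w r : 'rV[R]_m :=
  \row_(i < m) deriven_on `[a, +oo[ i w r.

Definition is_solution a m (Q : R -> 'rV[R]_m -> R) w :=
  [/\ forall i r, (i.+1 < m)%N -> a <= r ->
        derivable_on `[a, +oo[ (deriven_on `[a, +oo[ i w) r,
      forall i, (i < m)%N -> loc_abs_continuous a (deriven_on `[a, +oo[ i w),
      {ae leb R, forall r, a <= r ->
        derivable_on `[a, +oo[ (deriven_on `[a, +oo[ m.-1 w) r /\
        deriven_on `[a, +oo[ m w r = Q r (jet a m w r)} &
      forall i r, (i < m)%N -> a <= r ->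
        0 <= (-1) ^+ i * deriven_on `[a, +oo[ i w r].

Definition nontrivial a w := exists2 r, a <= r & w r <> 0.

Definition singular_first_kind a w :=
  nontrivial a w /\ (\forall r \near +oo, w r = 0).

Definition gfun (theta : R) h (t : R) : R :=
  inf (h @` `]t / theta, theta * t[).

(* For [a > 0], [1 < sigma] and [b i] in [Linfty_loc a] the essential suprema
   are finite, so that [fine] loses nothing. *)
Definition ffun_coef a (sigma : R) m q b r : R :=
  q r / (1 + \sum_(1 <= i < m) r ^+ (m - i) *
    fine (ess_sup_on (`]r / sigma, r * sigma[ `&` `[a, +oo[) (b i))).

End Defs.

(* Main.v *)
(** Suppose that [w] never vanishes.  The functions [u i = (-1)^i w^(i)] are
nonnegative and [u i' = - u (i+1)], so the drop [D = w r - w r'] bounds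
[u i - u i r'] by [D / d^i] after [i] steps of length [d].  Adding [B i * u (i-1)], with [B i] the
essential supremum of [b i] on [r, r'], to [u (m-1)] absorbs the lower order
terms, and integrating the equation gives, for [F r] the integral of
[xi^(m-1) f] over [a, r],
  [gam * d^(m-1) * (F r' - F (r + (m-1) d)) <= r'^(m-1) * (w r - w r')]
whenever [h o w >= gam] on [r, r'] and [r' < sigma r].  The limsup hypothesis
bounds the growth of [F] on short intervals, which allows the choice of [d]
proportional to [r (F r' - F r) / F r'] and yields
  [F(r')^(1/m) <= F(r)^(1/m) + const * (T / gam)^(1/m)]
as long as [w <= T] and [h o w >= gam].  Applying this while [w] decreases from
[theta^-j] to [theta^-(j+1)] and summing over [j], the increments are dominated
by the integral of [g^(-1/m) t^(1/m-1)] over (0, 1), so [F] is bounded, which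
contradicts the divergence of its defining integral. *)

Require Import Defs.
From mathcomp Require Import all_boot all_order all_algebra.
From mathcomp Require Import all_classical all_reals all_analysis.
From mathcomp Require Import ess_sup_inf measurable_realfun ring lra.
Import Order.TTheory GRing.Theory Num.Theory.
Import numFieldNormedType.Exports.

Set Implicit Arguments.
Unset Strict Implicit.
Unset Printing Implicit Defensive.

Local Open Scope classical_set_scope.
Local Open Scope ring_scope.

(** * One-sided slope bounds *)

(** The equation holds only almost everywhere and [w^(m-1)] is merely absolutely continuous, so
    slopes are turned into increments by half of the fundamental theorem of calculus: a slope at
    most [- q] off a null set bounds the integral of [q] by the drop. This is proved by real
    induction. The root of order [m] arises as follows. With [dF = F r' - F r] and [d] proportional
    to [r * dF / F r'], the estimate reads [gam * dF^m <= const * F(r')^(m-1) * (w r - w r')]. If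
    [p] and [q] are the roots of [F r'] and [F r], then [(p - q) * p^(m-1) <= p^m - q^m = dF], and
    [F(r')] cancels. This needs [r'] within a fixed ratio of [r], because the windows in [f] compare
    the [b i] only over ratios below [sigma]. The interval on which [w] decreases by a factor
    [theta] may be far longer, and a sum of roots over its pieces is not controlled by one root.
    Beyond the first piece [d] is therefore a fixed proportion of the radius: the increments of [F]
    are then linear in the drops of [w], the drops telescope, and a single root is taken at the
    end. *)

Section Straddle.
Context {R : realType}.
Implicit Types (c d p : R) (P : R -> Prop) (z : R -> R) (A : set R).

(** Real induction: around the supremum of the points satisfying [P], the local rule carries [P]
    from a point just before it to a point after it, unless the supremum is [d]. It glues local
    estimates along an interval. *)
Lemma cousin c d P : c <= d ->
  (forall t, c <= t <= d -> exists2 e, 0 < e &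
     forall x y, c <= x -> x <= t -> t <= y -> y <= d -> y - x < e -> P x -> P y) ->
  P c -> P d.
Proof.
move=> cd loc Pc; pose S := [set x | [/\ c <= x, x <= d & P x]].
have Sc : S c by split.
have hS : has_sup S by split; [exists c | exists d => x -[]].
have cS : c <= sup S by apply: (ub_le_sup hS.2).
have Sd : sup S <= d by apply: (ge_sup hS.1) => x [].
have [|e e0 he] := loc (sup S); first by rewrite cS.
have e2 : 0 < e / 2 by rewrite divr_gt0.
have [x [cx xd Px] xS] := sup_adherent e2 hS.
have xt : x <= sup S by apply: (ub_le_sup hS.2).
pose y := Num.min (sup S + e / 2) d.
have yS : y <= sup S + e / 2 by rewrite ge_min lexx.
have Sy : sup S <= y by rewrite le_min Sd andbT; lra.
have yd : y <= d by rewrite ge_min lexx orbT.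
have Py : P y by apply: (he x) => //; lra.
have : y <= sup S by apply: (ub_le_sup hS.2); split => //; lra.
rewrite /y; case: (leP d (sup S + e / 2)) => [dS _|]; last lra.
by move: Py; rewrite /y (min_idPr dS).
Qed.

(* Straddling form of an upper bound [p] for the slope of [z] at [t] relative
   to [c, d]; it avoids derivatives and is stable under sums. *)
Definition straddle c d z p (t : R) := forall eps, 0 < eps ->
  exists2 e, 0 < e & forall x y, c <= x -> x <= t -> t <= y -> y <= d ->
    y - x < e -> z y - z x <= (p + eps) * (y - x).

Lemma straddle_le c d z p p' (t : R) : p <= p' ->
  straddle c d z p t -> straddle c d z p' t.
Proof.
move=> pp' zp eps eps0; have [e e0 he] := zp _ eps0.
exists e => // x y cx xt ty yd xy; apply: (le_trans (he x y _ _ _ _ _)) => //.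
by rewrite ler_wpM2r ?lerD2r //; lra.
Qed.

Lemma straddleD c d z z' p p' (t : R) :
  straddle c d z p t -> straddle c d z' p' t ->
  straddle c d (z \+ z') (p + p') t.
Proof.
move=> zp zp' eps eps0; have eps2 : 0 < eps / 2 by rewrite divr_gt0.
have [e e0 he] := zp _ eps2; have [e' e0' he'] := zp' _ eps2.
exists (Num.min e e'); first by rewrite lt_min e0.
move=> x y cx xt ty yd; rewrite lt_min => /andP[xye xye'].
have h1 := he x y cx xt ty yd xye; have h2 := he' x y cx xt ty yd xye'.
rewrite (_ : _ * (y - x) = (p + eps / 2) * (y - x) + (p' + eps / 2) * (y - x)).
  by rewrite /=; lra.
by field.
Qed.

Lemma straddleZ c d z p k (t : R) : 0 <= k -> straddle c d z p t ->
  straddle c d (fun x => k * z x) (k * p) t.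
Proof.
rewrite le_eqVlt => /predU1P[<- _ eps eps0|k0 zp eps eps0].
  exists 1 => // x y cx xt ty yd _; rewrite !mul0r subrr add0r.
  by apply: mulr_ge0; lra.
have [e e0 he] := zp _ (divr_gt0 eps0 k0); exists e => // x y *.
rewrite -mulrBr; apply: le_trans (ler_wpM2l (ltW k0) (he x y _ _ _ _ _)) _ => //.
have k0' := gt_eqF k0.
by rewrite le_eqVlt; apply/orP; left; apply/eqP; field; rewrite k0'.
Qed.

Lemma straddle_sum c d (I : Type) (s : seq I) (P : pred I) (z : I -> R -> R)
    (p : I -> R) (t : R) : (forall i, P i -> straddle c d (z i) (p i) t) ->
  straddle c d (fun x => \sum_(i <- s | P i) z i x) (\sum_(i <- s | P i) p i) t.
Proof.
move=> zp; elim: s => [|i s IH].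
  move=> eps eps0; exists 1 => // x y cx xt ty yd _; rewrite !big_nil.
  by rewrite subrr add0r; apply: mulr_ge0; lra.
rewrite [X in straddle _ _ X](_ : _ = fun x => (if P i then z i x else 0) +
  \sum_(j <- s | P j) z j x); last first.
  by apply/funext => x; rewrite big_cons; case: ifP; rewrite ?add0r.
rewrite big_cons; case: ifPn => [Pi|_]; first exact: straddleD (zp _ Pi) IH.
by under eq_fun do rewrite add0r.
Qed.

(** The chord over [[x, y]] is the weighted mean of the chords over [[x, t]] and [[t, y]], whose
    slopes are both within [eps] of [D]. *)
Lemma cvg_diff_quot_straddle a c d z (D t : R) : a <= c -> c <= t <= d ->
  diff_quot z t y @[y --> within `[a, +oo[ t^'] --> D -> straddle c d z D t.
Proof.
move=> ac /andP[ct td] + eps eps0.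
move=> /cvgrPdist_le/(_ _ eps0).
case/nbhs_ballP => e /= e0 he.
exists e => // x y cx xt ty yd xy.
have key (s : R) : a <= s -> `|t - s| < e -> s != t ->
    `|D - diff_quot z t s| <= eps.
  by move=> as_ ts st; apply: he => //=; rewrite in_itv /= as_.
have hy : z y - z t <= (D + eps) * (y - t).
  have [->|yt] := eqVneq y t; first by rewrite !subrr mulr0.
  have yt0 : 0 < y - t by rewrite subr_gt0 lt_neqAle eq_sym yt.
  have := key y _ _ yt; rewrite ler_distl /diff_quot => H.
  rewrite -ler_pdivrMr //.
  have /andP[] : D - eps <= (z y - z t) / (y - t) <= D + eps.
    by rewrite -ler_distl distrC key //; [lra | rewrite ltr_distl; lra].
  by [].
have hx : z t - z x <= (D + eps) * (t - x).
  have [->|xt'] := eqVneq x t; first by rewrite !subrr mulr0.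
  have xt0 : 0 < t - x by rewrite subr_gt0 lt_neqAle xt'.
  rewrite -ler_pdivrMr //.
  have /andP[] : D - eps <= (z x - z t) / (x - t) <= D + eps.
    by rewrite -ler_distl distrC key //; [lra | rewrite ltr_distl; lra].
  by rewrite -[z x - z t]opprB -[x - t]opprB invrN mulrNN.
by move: hx hy; rewrite !mulrBr; lra.
Qed.

(** In contrast to [straddleZ], the sign of [k] is free, since a derivative bounds slopes from both
    sides; the application takes [k = (-1)^i]. *)
Lemma derive_on_straddle a c d z k (t : R) : a <= c -> c <= t <= d ->
  derivable_on `[a, +oo[ z t ->
  straddle c d (fun x => k * z x) (k * derive_on `[a, +oo[ z t) t.
Proof.
move=> ac ctd dz; apply: (cvg_diff_quot_straddle ac ctd).
rewrite (_ : diff_quot _ t = fun y => k * diff_quot z t y); last first.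
  by apply/funext => y; rewrite /diff_quot -mulrBr mulrA.
by apply: cvgM; [exact: cvg_cst | exact: dz].
Qed.

End Straddle.

(** * Absolutely continuous functions with negative slope almost everywhere *)

Section Lebesgue.
Context {R : realType}.
Implicit Types (c d : R) (z : R -> R) (A U N K : set R).
Local Notation mu := (leb R).

Lemma leb_borel A : measurable A -> measurable (A : set (lebesgueType R)).
Proof. exact: sub_caratheodory. Qed.

Lemma leb_itv (i : interval R) :
  mu [set` i] = (if i.1 < i.2 then (i.2 : \bar R) - i.1 else 0)%E.
Proof. exact: (@lebesgue_measure_itv R i). Qed.

Lemma leb_outer_open A (e : R) : 0 < e ->
  exists U, [/\ open U, A `<=` U & (mu U <= mu A + e%:E)%E].
Proof. exact: outer_measure_open_le. Qed.

Lemma leb_negligible_open N (e : R) : 0 < e -> mu.-negligible N ->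
  exists U, [/\ open U, N `<=` U & (mu U <= e%:E)%E].
Proof.
move=> e0 [A /= [mA A0 NA]]; have [U [oU AU Ue]] := leb_outer_open A e0.
by exists U; split => //; [exact: subset_trans AU | rewrite A0 add0e in Ue].
Qed.

(** [K] is what remains of [[c, d]] after removing an open set that covers the complement of [A]
    with excess at most [e]. The measure of that complement is finite and cancels. *)
Lemma leb_inner_compact c d A (e : R) : 0 < e ->
  measurable (A : set (lebesgueType R)) -> A `<=` `[c, d] ->
  exists K, [/\ closed K, K `<=` A & (mu A <= mu K + e%:E)%E].
Proof.
move=> e0 mA Acd; pose I : set (lebesgueType R) := `[c, d]%classic.
have mI : measurable I by apply: leb_borel; exact: measurable_itv.
have Ifin : (mu I < +oo)%E.
  by rewrite leb_itv; case: ifP => _; rewrite ?ltry // -EFinB ltry.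
have [U [oU AU Ue]] := leb_outer_open (I `\` A) e0.
have mU : measurable (U : set (lebesgueType R)).
  by apply: leb_borel; exact: open_measurable.
exists (I `\` U); split.
- by rewrite setDE; apply: closedI; [exact: interval_closed | exact: open_closedC].
- by move=> x [Ix nUx]; apply: contrapT => nAx; apply: nUx; apply: AU.
- have mK : measurable (I `\` U) by exact: measurableD.
  have le1 : (mu I <= mu (I `\` U) + mu U)%E.
    rewrite -measureU //; last by rewrite setDE -setIA setICl setI0.
    apply: le_measure; rewrite ?inE //; first exact: measurableU.
    by move=> x Ix; have [Ux|nUx] := pselect (U x); [right|left; split].
  have I2 : mu I = (mu (I `\` A) + mu A)%E.
    rewrite -measureU //; first by rewrite setUC setDUK.
      exact: measurableD.
    by rewrite setDE -setIA setICl setI0.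
  have DAfin : mu (I `\` A) \is a fin_num.
    rewrite ge0_fin_numE //; apply: le_lt_trans Ifin.
    by apply: le_measure; rewrite ?inE //; exact: measurableD.
  have := le_trans le1 (leeD2l _ Ue); rewrite I2 addeCA leeD2lE //.
Qed.

(** Nothing is known about slopes on [N], but [z] varies little over intervals inside a small open
    neighborhood of [N]. Absolute continuity controls only a whole finite disjoint family, so these
    intervals are carried through the real induction and estimated together at the end. *)
Lemma abs_continuous_nonincreasing c d z N : c <= d -> abs_continuous c d z ->
  mu.-negligible N ->
  (forall x, c <= x <= d -> ~ N x -> straddle c d z 0 x) -> z d <= z c.
Proof.
move=> cd ACz N0 zN; apply/ler_addgt0Pr => e e0.
(* The slopes off [N] cost [e' * (d - c)] and the exceptional intervals cost [e'], which makes [e]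
   in total. *)
pose e' := e / (d - c + 1); have dc : 0 < d - c + 1 by lra.
have e'0 : 0 < e' by rewrite divr_gt0.
have [delta delta0 hdelta] := ACz _ e'0.
have d2 : 0 < delta / 2 by rewrite divr_gt0.
have [U [oU NU Ud]] := leb_negligible_open d2 N0.
have mU : measurable (U : set (lebesgueType R)).
  by apply: leb_borel; exact: open_measurable.
have mitv (i : interval R) : measurable ([set` i] : set (lebesgueType R)).
  by apply: leb_borel; exact: measurable_itv.
(* [s] lists disjoint intervals inside the small open set [U]; [z] grows slowly
   except on them. *)
pose P x := exists s : seq (R * R),
  [/\ all (fun p => [&& c <= p.1, p.1 <= p.2 & p.2 <= x]) s,
      pairwise (fun p q => q.2 <= p.1) s,
      ((\sum_(p <- s) (p.2 - p.1))%:E <= mu (U `&` `]c, x]))%E &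
      z x - z c <= e' * (x - c) + \sum_(p <- s) `|z p.2 - z p.1|].
have : P d.
  apply: (cousin cd); last first.
    by exists [::]; split => //; rewrite !big_nil ?subrr ?mulr0 ?addr0.
  move=> t /andP[ct td]; have [Nt|nNt] := pselect (N t).
    have /nbhs_ballP[r /= r0 rU] : nbhs t U by apply: open_nbhs_nbhs; split; auto.
    exists r => // x y cx xt ty yd xyr [s [h1 h2 h3 h4]].
    exists ((x, y) :: s); split => /=.
    - rewrite cx lexx andbT; apply/andP; split; first by lra.
      by apply: sub_all h1 => p /and3P[-> -> px] /=; lra.
    - by rewrite h2 andbT; apply: sub_all h1 => p /and3P[].
    - have xyU : `]x, y]%classic `<=` U.
        move=> u /=; rewrite in_itv /= => /andP[xu uy]; apply: rU.
        by rewrite /ball /= ltr_distl; lra.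
      (* The new interval [(x, y]] lies in [U] and is disjoint from the part of [U] up to [x] that
         bounds the old lengths, so the measures add. *)
      have := @le_measure _ _ _ mu ((U `&` `]c, x]) `|` `]x, y]) (U `&` `]c, y]).
      rewrite !inE => /(_ _ _ _) H.
      rewrite big_cons EFinD; apply: le_trans (H _ _ _).
      + rewrite measureU //.
        * rewrite addeC leeD //= leb_itv /=; case: ifPn => //.
          by rewrite lte_fin -leNgt => yx; rewrite lee_fin; lra.
        * by apply: measurableI.
        * apply/seteqP; split => // u [[_]] /=; rewrite !in_itv /=; lra.
      + by apply: measurableU => //; apply: measurableI.
      + by apply: measurableI.
      + move=> u [[Uu cu]|xyu]; split.
        * by [].
        * by move: cu; rewrite /= !in_itv /=; lra.
        * exact: xyU.
        * by move: xyu; rewrite /= !in_itv /=; lra.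
    - rewrite big_cons /=; have : z y - z x <= `|z y - z x| by exact: ler_norm.
      have : e' * (x - c) <= e' * (y - c) by rewrite ler_pM2l //; lra.
      by lra.
  have [|r r0 hr] := zN t _ nNt e' e'0; first by rewrite ct.
  exists r => // x y cx xt ty yd xyr [s [h1 h2 h3 h4]].
  exists s; split => //.
  - by apply: sub_all h1 => p /and3P[-> -> px] /=; lra.
  - apply: le_trans h3 _; apply: le_measure; rewrite ?inE; try exact: measurableI.
    by move=> u [Uu cu]; split => //; move: cu; rewrite /= !in_itv /=; lra.
  - have := hr _ _ cx xt ty yd xyr; rewrite add0r.
    rewrite (_ : e' * (y - c) = e' * (x - c) + e' * (y - x)); last by ring.
    by lra.
move=> [s [h1 h2 h3 h4]].
pose xs (i : 'I_(size s)) := (nth (0, 0) s i).1.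
pose ys (i : 'I_(size s)) := (nth (0, 0) s i).2.
have hA i : [/\ c <= xs i, xs i <= ys i & ys i <= d].
  by move/(all_nthP (0, 0)): (h1) => /(_ _ (ltn_ord i))/and3P[].
have hB : trivIset setT (fun i => `]xs i, ys i[%classic).
  move=> i j _ _ [u []]; rewrite /= !in_itv /= => hi hj; apply: val_inj.
  have /(pairwiseP (0, 0)) hp := h2.
  case: (ltngtP i j) => // ij.
    by have /= : ys j <= xs i := hp _ _ (ltn_ord i) (ltn_ord j) ij;
      move=> ?; exfalso; clear hp; lra.
  by have /= : ys i <= xs j := hp _ _ (ltn_ord j) (ltn_ord i) ij;
      move=> ?; exfalso; clear hp; lra.
have sumE (F : R * R -> R) : \sum_(p <- s) F p = \sum_(i < size s) F (xs i, ys i).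
  rewrite (big_nth (0, 0)) big_mkord; apply: eq_bigr => i _.
  by rewrite /xs /ys -surjective_pairing.
have hC : \sum_(i < size s) (ys i - xs i) < delta.
  have : ((\sum_(p <- s) (p.2 - p.1))%:E <= (delta / 2)%:E)%E.
    apply: le_trans h3 (le_trans _ Ud); apply: le_measure; rewrite ?inE //.
    exact: measurableI.
  by rewrite lee_fin sumE /=; lra.
have h5 := hdelta _ _ _ hA hB hC; rewrite sumE /= in h4.
have : e' * (d - c) + e' = e by rewrite /e'; field; lra.
by lra.
Qed.

End Lebesgue.

(** * Stability of absolute continuity, and primitives of indicators *)

Section AbsContinuous.
Context {R : realType}.
Implicit Types (c d : R) (z q : R -> R) (N K : set R).
Local Notation mu := (leb R).

Lemma abs_continuousD c d z z' : abs_continuous c d z ->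
  abs_continuous c d z' -> abs_continuous c d (z \+ z').
Proof.
move=> hz hz' e e0; have e2 : 0 < e / 2 by rewrite divr_gt0.
have [de de0 h] := hz _ e2; have [de' de'0 h'] := hz' _ e2.
exists (Num.min de de'); first by rewrite lt_min de0.
move=> n x y hxy tI; rewrite lt_min => /andP[/(h n x y hxy tI) H /(h' n x y hxy tI) H'].
apply: (@le_lt_trans _ _ (\sum_(i < n) `|z (y i) - z (x i)| +
   \sum_(i < n) `|z' (y i) - z' (x i)|)); last lra.
rewrite -big_split /=; apply: ler_sum => i _.
by rewrite opprD addrACA; exact: ler_normD.
Qed.

Lemma lipschitz_abs_continuous c d z (k : R) :
  (forall x y, c <= x -> x <= y -> y <= d -> `|z y - z x| <= k * (y - x)) ->
  abs_continuous c d z.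
Proof.
move=> zk e e0; pose k' := `|k| + 1; have k'0 : 0 < k' by rewrite ltr_wpDl.
exists (e / k'); first by rewrite divr_gt0.
move=> n x y hxy tI; rewrite ltr_pdivlMr // mulr_suml.
apply: le_lt_trans; apply: ler_sum => i _; have [cx xy yd] := hxy i.
apply: le_trans (zk _ _ cx xy yd) _; rewrite mulrC ler_wpM2l //; first lra.
by rewrite /k' (le_trans (ler_norm k)) // lerDl.
Qed.

Lemma abs_continuousZ c d z k : abs_continuous c d z ->
  abs_continuous c d (fun x => k * z x).
Proof.
move=> hz e e0; pose k' := `|k| + 1; have k'0 : 0 < k' by rewrite ltr_wpDl.
have [de de0 h] := hz _ (divr_gt0 e0 k'0); exists de => // n x y hxy tI xyde.
have := h n x y hxy tI xyde; rewrite ltr_pdivlMr // mulr_suml.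
apply: le_lt_trans; apply: ler_sum => i _.
by rewrite -mulrBr normrM mulrC ler_wpM2l // lerDl.
Qed.

Lemma abs_continuous_sum c d (I : Type) (s : seq I) (P : pred I)
    (z : I -> R -> R) : (forall i, P i -> abs_continuous c d (z i)) ->
  abs_continuous c d (fun x => \sum_(i <- s | P i) z i x).
Proof.
move=> hz; elim: s => [|i s IH].
  apply: (@lipschitz_abs_continuous _ _ _ 0) => x y _ _ _.
  by rewrite !big_nil subrr normr0 mul0r.
rewrite [X in abs_continuous _ _ X](_ : _ = fun x => (if P i then z i x else 0) +
  \sum_(j <- s | P j) z j x); last first.
  by apply/funext => x; rewrite big_cons; case: ifP; rewrite ?add0r.
case Pi: (P i); first exact: abs_continuousD (hz _ Pi) IH.
by under eq_fun do rewrite add0r.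
Qed.

(** A primitive of the indicator of [K] starting at [c]. *)
Definition partial_length c K (x : R) : R := fine (mu (K `&` `[c, x])).

Let mitv (i : interval R) : measurable ([set` i] : set (lebesgueType R)).
Proof. by apply: leb_borel; exact: measurable_itv. Qed.

Let mclosed K : closed K -> measurable (K : set (lebesgueType R)).
Proof. by move=> cK; apply: leb_borel; exact: closed_measurable. Qed.

Lemma leb_itv_fin K c d : closed K -> mu (K `&` `[c, d]) \is a fin_num.
Proof.
move=> cK; rewrite ge0_fin_numE //.
apply: (@le_lt_trans _ _ (mu `[c, d]%classic)).
  by apply: le_measure; rewrite ?inE //; apply: measurableI => //; exact: mclosed.
by rewrite leb_itv; case: ifP => _; rewrite ?ltry // -EFinB ltry.
Qed.

Lemma partial_length_le c K x y : closed K -> c <= x -> x <= y ->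
  0 <= partial_length c K y - partial_length c K x <= y - x.
Proof.
move=> cK cx xy; have mK := mclosed cK.
have mKI (i : interval R) : measurable (K `&` [set` i] : set (lebesgueType R)).
  by apply: measurableI => //; exact: mitv.
rewrite subr_ge0 lerBlDr; apply/andP; split.
  rewrite /partial_length; apply: fine_le; rewrite ?leb_itv_fin //.
  apply: le_measure; rewrite ?inE // => u [Ku]; rewrite /= !in_itv /= => h.
  by split => //; lra.
rewrite -lee_fin EFinD !fineK ?leb_itv_fin //.
apply: (@le_trans _ _ (mu (`]x, y]%classic `|` (K `&` `[c, x])))).
  apply: le_measure; rewrite ?inE //; first exact: measurableU.
  move=> u [Ku]; rewrite /= !in_itv /= => h.
  have [xu|ux] := ltP x u; [left|right].
    by move: h; case/andP.
  by split => //; lra.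
rewrite measureU //.
  apply: leeD2r; rewrite [X in (X <= _)%E](leb_itv `]x, y]) /=.
  by case: ifP => // _; rewrite lee_fin subr_ge0.
by apply/seteqP; split => // u [] /=; rewrite in_itv /= => h [_]; rewrite /= in_itv /=; lra.
Qed.

Lemma partial_length_start c K : partial_length c K c = 0.
Proof.
rewrite /partial_length (_ : mu _ = 0) //; apply/eqP; rewrite eq_le measure_ge0 andbT.
have [Kc|nKc] := pselect (K c).
  rewrite (_ : _ `&` _ = `[c, c]%classic); first by rewrite leb_itv /= ltxx.
  rewrite set_itv1; apply/seteqP; split => [u [_] //|u ->] //.
rewrite (_ : _ `&` _ = set0) ?measure0 //.
by rewrite set_itv1; apply/seteqP; split => // u [Ku /= uc]; apply: nKc; rewrite -uc.
Qed.

(** Closedness of [K] gives the bound at every point, not just almost everywhere, so no further null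
    set arises when these primitives are added to [z]. *)
Lemma partial_length_straddle c d K t : closed K -> c <= t <= d ->
  straddle c d (partial_length c K) (\1_K t) t.
Proof.
move=> cK /andP[ct td] eps eps0; rewrite indicE.
have [Kt|nKt] := pselect (K t).
  rewrite mem_set //; exists 1 => // x y cx xt ty yd _.
  have /andP[_ h] := partial_length_le cK cx (le_trans xt ty).
  apply: le_trans h _; rewrite mulrDl mul1r lerDl; apply: mulr_ge0; lra.
have /nbhs_ballP[e /= e0 he] : nbhs t (~` K).
  by apply: open_nbhs_nbhs; split => //; exact: closed_openC.
rewrite memNset //; exists e => // x y cx xt ty yd xye.
rewrite /partial_length (_ : K `&` `[c, y] = K `&` `[c, x]).
  by rewrite subrr add0r; apply: mulr_ge0; lra.
apply/seteqP; split => u [Ku]; rewrite /= !in_itv /= => h; split => //; last by lra.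
have [ux|xu] := leP u x; first by rewrite andbT; lra.
by exfalso; apply: (he u) => //; rewrite /ball /= ltr_distl; lra.
Qed.

End AbsContinuous.

(** * Integrals bounded by the drop of an absolutely continuous function *)

Section IntegralSlope.
Context {R : realType}.
Implicit Types (c d : R) (z q : R -> R) (N K : set R).
Local Notation mu := (leb R).
Import HBNNSimple.

(* [A y] is the level set of value [y] of a simple function below [q].  Each is
   replaced by a compact subset [K y], and [y * |K y `&` [c, x]|] is added to
   [z]: near a point of [K y] the slope of this term is at most [y], and it is
   locally constant off [K y]. *)
Lemma abs_continuous_level_sets c d z q N (S : seq R) (A : R -> set R) :
  c <= d -> uniq S -> abs_continuous c d z ->
  (forall x, c <= x <= d -> 0 <= q x) -> mu.-negligible N ->
  (forall x, c <= x <= d -> ~ N x -> straddle c d z (- q x) x) ->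
  (forall y, 0 < y -> measurable (A y : set (lebesgueType R))) ->
  (forall y, 0 < y -> A y `<=` `[c, d]) ->
  (forall y y' x, A y x -> A y' x -> y = y') ->
  (forall y x, 0 < y -> A y x -> y <= q x) ->
  (\sum_(y <- S | (0 < y)%R) y%:E * mu (A y) <= (z c - z d)%:E)%E.
Proof.
move=> cd uS ACz q0 N0 zq mA Acd dA Aq; apply/lee_addgt0Pr => e e0.
(* Passing from [A y] to [K y] loses at most [y * (e / W)] per level, hence at most [e] in total;
   the summand 1 keeps [W] positive. *)
pose W := \sum_(y <- S | 0 < y) y + 1.
have W0 : 0 < W by rewrite ltr_wpDl // sumr_ge0 // => y /ltW.
have e'0 : 0 < e / W by rewrite divr_gt0.
have /choice[K hK] : forall y, exists K, closed K /\ (0 < y ->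
    K `<=` A y /\ (mu (A y) <= mu K + (e / W)%:E)%E).
  move=> y; have [y0|y0] := ltP 0 y; last by exists set0; split => //; exact: closed0.
  have [K [cK KA h]] := leb_inner_compact e'0 (mA _ y0) (Acd _ y0).
  by exists K.
have cK y : closed (K y) by case: (hK y).
have KA y : 0 < y -> K y `<=` A y by case: (hK y) => _ h /h[].
pose Z x := z x + \sum_(y <- S | 0 < y) y * partial_length c (K y) x.
have ACZ : abs_continuous c d Z.
  apply: abs_continuousD => //; apply: abs_continuous_sum => y y0.
  apply: abs_continuousZ; apply: (@lipschitz_abs_continuous _ _ _ _ 1) => s t cs st td.
  have /andP[h1 h2] := partial_length_le (cK y) cs st.
  by rewrite ger0_norm // mul1r.
have ZN x : c <= x <= d -> ~ N x -> straddle c d Z 0 x.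
  move=> cxd Nx.
  have h : straddle c d Z (- q x + \sum_(y <- S | 0 < y) y * \1_(K y) x) x.
    apply: straddleD; first exact: zq.
    apply: straddle_sum => y y0; apply: straddleZ; first exact: ltW.
    exact: partial_length_straddle.
  apply: straddle_le h; rewrite addrC subr_le0.
  (* The level sets are disjoint, so at most one term of the sum is nonzero at [x], and its level is
     at most [q x]. *)
  have [[y [yS y0 Kyx]]|no] := pselect (exists y, [/\ y \in S, 0 < y & K y x]).
    rewrite -big_filter (bigD1_seq y) ?mem_filter ?y0 ?filter_uniq //= big1_seq ?addr0.
      rewrite indicE mem_set // mulr1; exact: (Aq _ _ y0 (KA _ y0 _ Kyx)).
    move=> y'; rewrite mem_filter => /andP[y'y /andP[y'0 _]].
    rewrite indicE memNset ?mulr0 // => Ky'x.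
    by move/eqP: y'y; apply; apply: (dA _ _ x (KA _ y'0 _ Ky'x) (KA _ y0 _ Kyx)).
  rewrite big_seq_cond big1 ?q0 // => y /andP[yS y0].
  by rewrite indicE memNset ?mulr0 // => Kyx; apply: no; exists y.
have := abs_continuous_nonincreasing cd ACZ N0 ZN.
rewrite /Z [X in _ <= _ + X]big1 ?addr0; last first.
  by move=> y _; rewrite partial_length_start mulr0.
move=> hZ.
have Kfin y : 0 < y -> mu (K y) = (partial_length c (K y) d)%:E.
  move=> y0; rewrite /partial_length fineK ?leb_itv_fin //; congr (mu _).
  by apply/seteqP; split => [x Kx|x []//]; split => //; exact: Acd (KA _ y0 _ Kx).
have h y : 0 < y -> (y%:E * mu (A y) <= (y * (partial_length c (K y) d + e / W))%:E)%E.
  move=> y0; rewrite EFinM; apply: lee_wpmul2l; first by rewrite lee_fin ltW.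
  by rewrite EFinD -Kfin //; case: (hK y) => _ /(_ y0)[].
apply: le_trans (lee_sum _ h) _; rewrite sumEFin -EFinD lee_fin.
under eq_bigr do rewrite mulrDr.
rewrite big_split /= -mulr_suml.
have : (\sum_(y <- S | 0 < y) y) * (e / W) <= e.
  have We : W * (e / W) = e by rewrite mulrC divfK ?gt_eqF.
  by rewrite -[X in _ <= X]We ler_wpM2r ?ltW // /W ltrDl.
by lra.
Qed.

(** The integral of a nonnegative function is the supremum of the integrals of the simple functions
    below it, and each of these is a finite sum over level sets. *)
Lemma abs_continuous_integral_le c d z q N : c <= d -> abs_continuous c d z ->
  (forall x, c <= x <= d -> 0 <= q x) -> mu.-negligible N ->
  (forall x, c <= x <= d -> ~ N x -> straddle c d z (- q x) x) ->
  (\int[mu]_(x in `[c, d]) (q x)%:E <= (z c - z d)%:E)%E.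
Proof.
move=> cd ACz q0 N0 zq; rewrite ge0_integralE; last first.
  by move=> x; rewrite /= in_itv /= => h; rewrite lee_fin q0.
apply: ge_ereal_sup => _ [s /= hs <-].
have sout x : ~ (c <= x <= d) -> s x = 0.
  move=> nx; apply/eqP; rewrite eq_le fun_ge0 andbT -lee_fin.
  by apply: le_trans (hs x) _; rewrite /patch memNset //= in_itv.
have sin x : c <= x <= d -> s x <= q x.
  by move=> hx; rewrite -lee_fin; apply: le_trans (hs x) _; rewrite /patch mem_set //= in_itv.
rewrite sintegralE fsbig_finite //=.
rewrite (bigID (fun y => (0 < y)%R)) /= [X in (_ + X)%E]big_seq_cond.
rewrite [X in (_ + X)%E]big1 ?adde0; last first.
  move=> y /andP[]; rewrite in_fset_set // inE => -[x _ <-].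
  rewrite -leNgt => sx; rewrite (_ : s x = 0) ?mul0e //.
  by apply/eqP; rewrite eq_le sx fun_ge0.
apply: (@abs_continuous_level_sets _ _ _ q N _ (fun y => s @^-1` [set y])) => //.
- exact: finmap.fset_uniq.
- move=> y y0 x /= sxy; rewrite in_itv /=; apply: contrapT => /negP nx.
  by move: y0; rewrite -sxy sout ?ltxx //; exact/negP.
- by move=> y y' x /= <- <-.
- move=> y x y0 /= sxy; rewrite -sxy; apply: sin; apply: contrapT => nx.
  by move: y0; rewrite -sxy sout // ltxx.
Qed.
End IntegralSlope.

(** * Essential suprema on moving windows *)

Section EssSup.
Context {R : realType}.
Implicit Types (a c d : R) (f : R -> R) (D : set R).
Local Notation mu := (leb R).

Lemma ae_mono (P Q : R -> Prop) : (forall x, P x -> Q x) ->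
  {ae mu, forall x, P x} -> {ae mu, forall x, Q x}.
Proof.
move=> PQ [A [mA A0 NA]]; exists A; split => //.
by apply: subset_trans NA => x nQ /PQ.
Qed.

Lemma ess_sup_on_leP D f (y : R) :
  (ess_sup_on D f <= y%:E)%E <-> {ae mu, forall x, D x -> f x <= y}.
Proof.
split.
  move/ess_supP; apply: filterS => x /= + Dx.
  by rewrite /patch mem_set //= lee_fin.
move=> h; apply/ess_supP; apply: ae_mono h => x /= h.
by rewrite /patch; case: ifPn => [|_]; rewrite ?leNye // inE => /h; rewrite lee_fin.
Qed.

Lemma ess_sup_onS D D' f : D `<=` D' -> (ess_sup_on D f <= ess_sup_on D' f)%E.
Proof.
move=> DD'; apply: le_ess_sup; apply: nearW => x.
rewrite /patch; case: ifPn; rewrite ?leNye // inE => Dx.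
by rewrite mem_set //; exact: DD'.
Qed.

Lemma ae_itv_inhabited (x y : R) (P : R -> Prop) : x < y ->
  {ae mu, forall u, x < u < y -> P u} -> exists2 u, x < u < y & P u.
Proof.
move=> xy h; apply: contrapT => no.
have [A /= [mA A0 NA]] : {ae mu, forall u, ~ (x < u < y)}.
  by move: h; apply: ae_mono => u hu xuy; apply: no; exists u => //; exact: hu.
have : (mu `]x, y[%classic <= 0)%E.
  rewrite -A0; apply: le_measure; rewrite ?inE //.
    by apply: leb_borel; exact: measurable_itv.
  by move=> u xuy; apply: NA => /=; apply; move: xuy; rewrite /= in_itv.
by rewrite [X in (X <= _)%E](leb_itv `]x, y[) /= lte_fin xy -EFinB lee_fin; lra.
Qed.

Lemma Linfty_loc_bound a f c d : Linfty_loc a f -> a <= c ->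
  exists2 M, 0 <= M & {ae mu, forall x, c <= x <= d -> `|f x| <= M}.
Proof.
move=> [_ h] ac; have := h _ d ac.
case E : (ess_sup_on _ _) => [M| |] // _; last first.
  (* The value [-oo] occurs when [[c, d]] is a null set. *)
  exists 0 => //; have : (ess_sup_on `[c, d] (fun x => `|f x|%R) <= 0%:E)%E by rewrite E leNye.
  by move/ess_sup_on_leP; apply: ae_mono => x h1 cxd; apply: h1; rewrite /= in_itv.
exists (Num.max 0 M); first by rewrite le_max lexx.
have : (ess_sup_on `[c, d] (fun x => `|f x|%R) <= M%:E)%E by rewrite E.
move/ess_sup_on_leP; apply: ae_mono => x h1 cxd.
by rewrite le_max h1 ?orbT //= in_itv.
Qed.

(** The open interval inside [D] has positive measure, which rules out a negative essential
    supremum, in particular [-oo], for a nonnegative [f]. *)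
Lemma ess_sup_on_fin a f c d (x y : R) D : Linfty_loc a f ->
  (forall r, a <= r -> 0 <= f r) -> a <= c -> D `<=` `[c, d] -> x < y ->
  `]x, y[ `<=` D ->
  ess_sup_on D f = (fine (ess_sup_on D f))%:E /\ 0 <= fine (ess_sup_on D f).
Proof.
move=> hf f0 ac Dcd xy xyD.
have [M M0 hM] := Linfty_loc_bound d hf ac.
have leM : (ess_sup_on D f <= M%:E)%E.
  apply/ess_sup_on_leP; move: hM; apply: ae_mono => u hu Du.
  apply: le_trans (ler_norm _) (hu _).
  by have := Dcd _ Du; rewrite /= in_itv.
have ge0 : (0 <= ess_sup_on D f)%E.
  rewrite leNgt; apply/negP => lt0.
  have [e he] : exists2 e, e < 0 & (ess_sup_on D f <= e%:E)%E.
    move: lt0; case: (ess_sup_on D f) => [e| |] //; first by exists e.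
    by exists (-1) => //; rewrite ?leNye ?oppr_lt0.
  move/ess_sup_on_leP => h.
  have [u xuy] : exists2 u, x < u < y & f u <= e.
    apply: ae_itv_inhabited => //; move: h; apply: ae_mono => u h xuy; apply: h.
    by apply: xyD; rewrite /= in_itv.
  have : D u by apply: xyD; rewrite /= in_itv.
  move/Dcd; rewrite /= in_itv /= => /andP[cu _].
  by have := f0 u (le_trans ac cu); lra.
by move: leM ge0; case: (ess_sup_on D f).
Qed.

Let window (sigma a r : R) : set R := `]r / sigma, r * sigma[ `&` `[a, +oo[.

Lemma windowS (sigma a r : R) : 0 < a -> 1 < sigma -> a <= r ->
  [/\ window sigma a r `<=` `[a, r * sigma], r < r * sigma &
      `]r, r * sigma[ `<=` window sigma a r].
Proof.
move=> a0 s1 ar; split.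
- by move=> x []; rewrite /= !in_itv /=; lra.
- by rewrite ltr_pMr //; lra.
- move=> x; rewrite /window /= !in_itv /= => /andP[rx xs]; rewrite xs andbT; split; last lra.
  by rewrite ltr_pdivrMr; nra.
Qed.

Lemma ess_sup_window_fin (sigma a r : R) f : 0 < a -> 1 < sigma -> a <= r ->
  Linfty_loc a f -> (forall x, a <= x -> 0 <= f x) ->
  ess_sup_on (window sigma a r) f = (fine (ess_sup_on (window sigma a r) f))%:E /\
  0 <= fine (ess_sup_on (window sigma a r) f).
Proof.
move=> a0 s1 ar hf f0; have [h1 h2 h3] := windowS a0 s1 ar.
exact: (ess_sup_on_fin hf f0 (lexx a) h1 h2 h3).
Qed.

(** The essential supremum over a window exceeds [y] exactly when [f <= y] fails on a non-null part
    of some rational interval [(p, q)] inside the window. The [r] whose window contains [(p, q)]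
    form an interval, so each superlevel set is a countable union of intervals. *)
Lemma measurable_ess_sup_window (sigma a : R) f : 0 < a -> 1 < sigma ->
  Linfty_loc a f -> (forall x, a <= x -> 0 <= f x) ->
  lmeasurable_fun `[a, +oo[ (fun r => fine (ess_sup_on (window sigma a r) f)).
Proof.
move=> a0 s1 hf f0; rewrite /lmeasurable_fun => mD.
have s0 : 0 < sigma by lra.
apply: (measurability _ (RGenOInfty.measurableE R)) => //.
move=> /= _ [_ [y ->] <-]; rewrite preimage_itvoy.
pose G (p : rat * rat) : set R :=
  if `[< {ae mu, forall x, ratr p.1 < x < ratr p.2 -> a <= x -> f x <= y} >]
  then set0 else `[a, +oo[ `&` `[ratr p.2 / sigma, ratr p.1 * sigma].
rewrite [X in measurable X](_ : _ = \bigcup_p \bigcup_q G (p, q)); last first.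
  apply/seteqP; split.
    move=> r [] /=; rewrite in_itv /= andbT => ar yS; apply: contrapT => no.
    have [fin _] := ess_sup_window_fin a0 s1 ar hf f0.
    move: yS; apply/negP; rewrite -leNgt -lee_fin -fin; apply/ess_sup_on_leP.
    pose P (pq : rat * rat) x := r / sigma <= ratr pq.1 -> ratr pq.2 <= r * sigma ->
      ratr pq.1 < x < ratr pq.2 -> a <= x -> f x <= y.
    have key pq : {ae mu, forall x, P pq x}.
      have [h1|h1] := leP (r / sigma) (ratr pq.1); last first.
        by apply: nearW; move=> x rp; move: (le_lt_trans rp h1); rewrite ltxx.
      have [h2|h2] := leP (ratr pq.2) (r * sigma); last first.
        by apply: nearW; move=> x _ rq; move: (lt_le_trans h2 rq); rewrite ltxx.
      suff : {ae mu, forall x, ratr pq.1 < x < ratr pq.2 -> a <= x -> f x <= y}.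
        by apply: ae_mono => x h _ _.
      apply: contrapT => nae; apply: no; exists pq.1 => //; exists pq.2 => //.
      rewrite /G asboolF //; split; rewrite /= in_itv /= ?andbT //.
      by rewrite ler_pdivrMr // h2 -ler_pdivrMr.
    (* The pairs of rationals are enumerated by naturals in order to merge countably many null sets
       into one. *)
    have : {ae mu, forall x n, if unpickle n is Some pq then P pq x else True}.
      apply: ae_foralln => n; case: (unpickle n : option (rat * rat)) => [pq|].
        exact: key.
      exact: nearW.
    apply: ae_mono => x hx [] /=; rewrite !in_itv /= andbT => /andP[rx xr] ax.
    have [p] := rat_in_itvoo rx; rewrite /= in_itv /= => /andP[rp px].
    have [q] := rat_in_itvoo xr; rewrite /= in_itv /= => /andP[xq qr].
    have := hx (pickle (p, q)); rewrite pickleK; apply => //=; try exact: ltW.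
    by rewrite px xq.
  move=> r [p _ [q _]]; rewrite /G; case: asboolP => // nae [] /=.
  rewrite !in_itv /= andbT => ar /andP[h1 h2]; split; first by rewrite ar.
  have [fin _] := ess_sup_window_fin a0 s1 ar hf f0.
  rewrite ltNge; apply/negP => hle; apply: nae; move: hle.
  rewrite -lee_fin -fin => /ess_sup_on_leP; apply: ae_mono => x hx /andP[px xq] ax.
  apply: hx; split; rewrite /= in_itv /= ?andbT //; apply/andP; split.
    by apply: le_lt_trans px; rewrite ler_pdivrMr.
  by apply: (lt_le_trans xq); rewrite -ler_pdivrMr.
apply: bigcupT_measurable_rat => p; apply: bigcupT_measurable_rat => q.
rewrite /G; case: asboolP => _ //.
by apply: leb_borel; apply: measurableI; exact: measurable_itv.
Qed.

End EssSup.

(** * The weight and its primitive *)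

Section Primitive.
Context {R : realType}.
Variables (a : R) (phi : R -> R).
Local Notation mu := (leb R).
Hypothesis phi_ge0 : forall x, a <= x -> 0 <= phi x.
Hypothesis mphi : lmeasurable_fun `[a, +oo[ phi.
Hypothesis phi_bounded : forall d, exists M, {ae mu, forall x, a <= x <= d -> phi x <= M}.

Definition primitive (r : R) : R := \int[mu]_(xi in `[a, r]) phi xi.

(** The comparison function [- k * t] has slope [- k], which is at most [- phi t] almost
    everywhere. *)
Lemma integral_le_ae (x y k : R) : a <= x -> x <= y ->
  {ae mu, forall t, x <= t <= y -> phi t <= k} ->
  (\int[mu]_(t in `[x, y]) (phi t)%:E <= (k * (y - x))%:E)%E.
Proof.
move=> ax xy hk; rewrite (_ : k * (y - x) = - k * x - - k * y); last by ring.
apply: (@abs_continuous_integral_le _ _ _ (fun t => - k * t) phi _ _ _ _ hk) => //.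
- apply: (@lipschitz_abs_continuous _ _ _ _ `|k|) => s t xs st ty.
  by rewrite -mulrBr normrM normrN (ger0_norm (x := t - s)) // subr_ge0.
- by move=> t /andP[xt _]; apply: phi_ge0; lra.
- move=> t xty; rewrite /setC /= => /contrapT/(_ xty) phik eps eps0.
  exists 1 => // s u xs st tu uy _; rewrite -mulrBr ler_wpM2r //; lra.
Qed.

Let mitv (i : interval R) : measurable ([set` i] : set (lebesgueType R)).
Proof. by apply: leb_borel; exact: measurable_itv. Qed.

Let mphiS (D : set R) : measurable (D : set (lebesgueType R)) -> D `<=` `[a, +oo[ ->
  measurable_fun (D : set (lebesgueType R)) (fun x => (phi x)%:E).
Proof.
move=> mD Da; apply/measurable_EFinP; exact: (measurable_funS (mitv _) Da mphi).
Qed.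

Lemma primitiveE (r : R) : a <= r ->
  (\int[mu]_(xi in `[a, r]) (phi xi)%:E)%E = (primitive r)%:E.
Proof.
move=> ar; rewrite fineK //; have [M hM] := phi_bounded r.
rewrite ge0_fin_numE.
  exact: le_lt_trans (integral_le_ae (lexx a) ar hM) (ltry _).
by apply: integral_ge0 => x; rewrite /= in_itv /= lee_fin => /andP[+ _]; exact: phi_ge0.
Qed.

Lemma primitive_start : primitive a = 0.
Proof.
apply/eqP; rewrite eq_le -!lee_fin -primitiveE //; apply/andP; split.
  have [M hM] := phi_bounded a.
  by have := integral_le_ae (lexx a) (lexx a) hM; rewrite subrr mulr0.
by apply: integral_ge0 => x; rewrite /= in_itv /= lee_fin => /andP[+ _]; exact: phi_ge0.
Qed.

Lemma primitive_homo (x y : R) : a <= x -> x <= y -> primitive x <= primitive y.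
Proof.
move=> ax xy; rewrite -lee_fin -!primitiveE //; last lra.
apply: ge0_subset_integral; try exact: mitv.
- by apply: mphiS; [exact: mitv | move=> t; rewrite /= !in_itv /=; lra].
- by move=> t; rewrite /= in_itv /= lee_fin => /andP[+ _]; exact: phi_ge0.
- by move=> t; rewrite /= !in_itv /=; lra.
Qed.

Lemma primitive_sub (x y : R) : a <= x -> x <= y ->
  ((primitive y - primitive x)%:E <= \int[mu]_(t in `[x, y]) (phi t)%:E)%E.
Proof.
move=> ax xy; have ay : a <= y by lra.
rewrite EFinB leeBlDr // -!primitiveE //.
rewrite (_ : `[a, y]%classic = `[a, x]%classic `|` `]x, y]%classic); last first.
  apply/seteqP; split => t; rewrite /= !in_itv /=.
    by move=> h; have [tx|xt] := leP t x; [left|right]; lra.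
  by case; lra.
rewrite ge0_integral_setU /=; try exact: mitv.
- rewrite addeC leeD2r //.
  apply: ge0_subset_integral; try exact: mitv.
  + by apply: mphiS; [exact: mitv | move=> t; rewrite /= !in_itv /=; lra].
  + by move=> t; rewrite /= in_itv /= lee_fin => /andP[h _]; apply: phi_ge0; lra.
  + by move=> t; rewrite /= !in_itv /=; lra.
- apply: mphiS; first by apply: measurableU; exact: mitv.
  by move=> t [] /=; rewrite !in_itv /=; lra.
- by move=> t [] /=; rewrite in_itv /= lee_fin => /andP[h _]; apply: phi_ge0; lra.
- rewrite disj_set2E; apply/eqP/seteqP; split => // t [] /=; rewrite !in_itv /=; lra.
Qed.

Lemma primitive_sub_le (x y k : R) : a <= x -> x <= y ->
  {ae mu, forall t, x <= t <= y -> phi t <= k} ->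
  primitive y - primitive x <= k * (y - x).
Proof.
move=> ax xy hk; rewrite -lee_fin.
exact: le_trans (primitive_sub ax xy) (integral_le_ae ax xy hk).
Qed.

(** A bound [M] on the primitive would pass to the divergent integral by monotone convergence along
    [[a, a + n]]. *)
Lemma primitive_unbounded : (\int[mu]_(xi in `[a, +oo[) (phi xi)%:E = +oo)%E ->
  forall M, exists2 r, a <= r & M < primitive r.
Proof.
move=> hoo M; apply: contrapT => no.
have hM r : a <= r -> primitive r <= M.
  by move=> ar; rewrite leNgt; apply/negP => h; apply: no; exists r.
pose D (n : nat) : set (lebesgueType R) := `[a, a + n%:R]%classic.
have DE : \bigcup_n D n = `[a, +oo[%classic.
  apply/seteqP; split => t.
    by case=> n _; rewrite /D /= !in_itv /= andbT => /andP[].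
  rewrite /= in_itv /= andbT => at_; exists (Num.truncn (t - a)).+1 => //.
  rewrite /D /= in_itv /= at_ -lerBlDl; apply: ltW; exact: truncnS_gt.
have H : (\int[mu]_(x in D i) (phi x)%:E @[i --> \oo] -->
    \int[mu]_(x in \bigcup_i D i) (phi x)%:E)%E.
  apply: ge0_nondecreasing_set_cvg_integral.
  - move=> i j ij; apply/subsetPset => t; rewrite /D /= !in_itv /= => /andP[-> h].
    by apply: le_trans h _; rewrite lerD2l ler_nat.
  - by move=> i; exact: mitv.
  - by move=> i; apply: mphiS; [exact: mitv | move=> t; rewrite /D /= !in_itv /=; lra].
  - by move=> i t; rewrite /D /= in_itv /= lee_fin => /andP[h _]; exact: phi_ge0.
have : (\int[mu]_(xi in `[a, +oo[) (phi xi)%:E <= M%:E)%E.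
  rewrite -DE; apply: (cvge_to_le H).
  by apply: nearW => n; rewrite primitiveE ?lee_fin ?hM // ?lerDl.
by rewrite hoo.
Qed.

End Primitive.

(** * Measurability and local boundedness of the weight *)

Section Coefficient.
Context {R : realType}.
Variables (a sigma : R) (m : nat) (q : R -> R) (b : nat -> R -> R).
Local Notation mu := (leb R).
Hypotheses (a0 : 0 < a) (s1 : 1 < sigma).
Hypothesis q0 : forall r, a <= r -> 0 <= q r.
Hypothesis qL : Linfty_loc a q.
Hypothesis b0 : forall i, (1 <= i < m)%N -> forall r, a <= r -> 0 <= b i r.
Hypothesis bL : forall i, (1 <= i < m)%N -> Linfty_loc a (b i).

Local Notation f := (ffun_coef a sigma m q b).
Local Notation S i r := (fine (ess_sup_on (`]r / sigma, r * sigma[ `&` `[a, +oo[) (b i))).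
Local Notation den r := (1 + \sum_(1 <= i < m) r ^+ (m - i) * S i r).

Lemma ffun_coef_den_ge1 (r : R) : a <= r -> 1 <= den r.
Proof.
move=> ar; rewrite lerDl big_nat_cond; apply: sumr_ge0 => i; rewrite andbT => him.
apply: mulr_ge0; first by exact: exprn_ge0 (le_trans (ltW a0) ar).
exact: (ess_sup_window_fin a0 s1 ar (bL him) (b0 him)).2.
Qed.

Lemma ffun_coef_ge0 (r : R) : a <= r -> 0 <= f r.
Proof.
move=> ar; apply: divr_ge0; first exact: q0.
exact: le_trans ler01 (ffun_coef_den_ge1 ar).
Qed.

Lemma ffun_coef_le (r : R) : a <= r -> f r <= q r.
Proof.
move=> ar; have h := ffun_coef_den_ge1 ar; rewrite /ffun_coef.
rewrite ler_pdivrMr; last exact: (lt_le_trans ltr01 h).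
by rewrite ler_peMr // q0.
Qed.

Lemma lmeasurable_inv (D : set R) (g : R -> R) : (forall x, D x -> 0 < g x) ->
  lmeasurable_fun D g -> lmeasurable_fun D (fun x => (g x)^-1).
Proof.
move=> g0 mg; rewrite /lmeasurable_fun => mD.
apply: (measurability _ (RGenOInfty.measurableE R)) => //.
move=> /= _ [_ [y ->] <-]; rewrite preimage_itvoy.
have [y0|y0] := ltP 0 y; last first.
  rewrite (_ : _ `&` _ = D) //; apply/seteqP; split => [x []//|x Dx]; split => //=.
  by apply: le_lt_trans y0 _; rewrite invr_gt0 g0.
rewrite (_ : _ `&` _ = D `&` g @^-1` `]-oo, y^-1[%classic).
  by apply: mg => //; exact: measurable_itv.
apply/seteqP; split => x [Dx] /=; rewrite in_itv /= => h; split => //=.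
  by rewrite -[g x]invrK ltf_pV2 ?posrE ?invr_gt0 ?g0.
by rewrite -[y]invrK ltf_pV2 ?posrE ?invr_gt0 ?g0.
Qed.

Lemma lmeasurable_exprn (D : set R) n : lmeasurable_fun D (fun x => x ^+ n).
Proof.
move=> mD Y mY; apply: measurableI => //; apply: leb_borel.
rewrite -[X in measurable X]setTI.
by apply: (@exprn_measurable R setT n).
Qed.

Lemma lmeasurable_ffun_coef : lmeasurable_fun `[a, +oo[ f.
Proof.
apply: measurable_funM; first by case: qL.
apply: lmeasurable_inv.
  by move=> x; rewrite /= in_itv /= andbT => /ffun_coef_den_ge1; apply: lt_le_trans.
apply: measurable_funD; first exact: measurable_cst.
(* [measurable_sum] asks for measurability at every index, whereas [b i] is controlled only for
   [1 <= i < m]; hence the guard moves into the summand. *)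
rewrite [X in measurable_fun _ X](_ : _ = fun r => \sum_(i <- index_iota 1 m)
    (if (1 <= i < m)%N then r ^+ (m - i) * S i r else 0)); last first.
  apply/funext => r; rewrite big_nat_cond big_mkcond /=.
  by apply: eq_bigr => i _; rewrite andbT.
apply: measurable_sum => i; case him: (1 <= i < m)%N; last exact: measurable_cst.
apply: measurable_funM; first exact: lmeasurable_exprn.
exact: measurable_ess_sup_window a0 s1 (bL him) (b0 him).
Qed.

Let phi (x : R) := x ^+ m.-1 * f x.

Lemma weight_ge0 (x : R) : a <= x -> 0 <= phi x.
Proof.
move=> ax; apply: mulr_ge0; last exact: ffun_coef_ge0.
exact: exprn_ge0 (le_trans (ltW a0) ax).
Qed.

Lemma lmeasurable_weight : lmeasurable_fun `[a, +oo[ phi.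
Proof.
apply: measurable_funM; [exact: lmeasurable_exprn | exact: lmeasurable_ffun_coef].
Qed.

Lemma weight_bounded d : exists M, {ae mu, forall x, a <= x <= d -> phi x <= M}.
Proof.
have [M M0 hM] := Linfty_loc_bound d qL (lexx a).
exists (`|d| ^+ m.-1 * M); move: hM; apply: ae_mono => x h axd.
have /andP[ax xd] := axd.
apply: ler_pM; rewrite ?ffun_coef_ge0 //; first by exact: exprn_ge0 (le_trans (ltW a0) ax).
  apply: lerXn2r; rewrite ?nnegrE; [exact: le_trans (ltW a0) ax | by [] | ].
  by apply: le_trans xd _; exact: ler_norm.
by apply: le_trans (ffun_coef_le ax) (le_trans (ler_norm _) (h axd)).
Qed.

End Coefficient.

(** * The estimate on one interval *)

Section IntervalEstimate.
Context {R : realType}.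
Variables (a sigma : R) (n : nat) (q : R -> R) (b : nat -> R -> R) (h : R -> R).
Variable u : nat -> R -> R.
Local Notation mu := (leb R).
Local Notation m := n.+2.
Hypotheses (a0 : 0 < a) (s1 : 1 < sigma).
Hypothesis q0 : forall r, a <= r -> 0 <= q r.
Hypothesis qL : Linfty_loc a q.
Hypothesis b0 : forall i, (1 <= i < m)%N -> forall r, a <= r -> 0 <= b i r.
Hypothesis bL : forall i, (1 <= i < m)%N -> Linfty_loc a (b i).
Hypothesis u_ge0 : forall i r, (i < m)%N -> a <= r -> 0 <= u i r.
Hypothesis u_abs_continuous : forall i, (i < m)%N -> loc_abs_continuous a (u i).
Hypothesis u_straddle : forall i, (i < n.+1)%N -> forall c d t, a <= c ->
  c <= t <= d -> straddle c d (u i) (- u i.+1 t) t.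
(** For [u i = (-1)^i w^(i)] the derivative of [u (m-1)] is [- (-1)^m Q], and the structural
    inequality bounds it with [|w^(i)| = u i]. *)
Hypothesis u_last : {ae mu, forall t, a <= t -> forall c d, a <= c -> c <= t <= d ->
  straddle c d (u n.+1) (- (q t * h (u 0 t)) + \sum_(1 <= i < m) b i t * u i t) t}.

Let pred_lt i : (1 <= i < m)%N -> (i.-1 < n.+1)%N.
Proof. by case: i. Qed.

Let pred_ltm i : (1 <= i < m)%N -> (i.-1 < m)%N.
Proof. by move=> /pred_lt; exact: leqW. Qed.

Let pred_sub i : (1 <= i < m)%N -> (i.-1 + (m - i) = n.+1)%N.
Proof. by case: i => // i /andP[_ im]; rewrite subSS subnKC // ltnW. Qed.

Lemma drop_ge i k (x y : R) : (i < n.+1)%N -> a <= x -> x <= y ->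
  (forall t, x <= t <= y -> k <= u i.+1 t) -> k * (y - x) <= u i x - u i y.
Proof.
move=> i_n ax xy hk.
suff : u i y + k * y <= u i x + k * x by rewrite mulrBr; lra.
apply: (@abs_continuous_nonincreasing _ x y (fun t => u i t + k * t) set0 xy).
- apply: abs_continuousD; first by apply: u_abs_continuous => //; exact: leqW.
  apply: (@lipschitz_abs_continuous _ _ _ _ `|k|) => s t xs st ty.
  by rewrite -mulrBr normrM (ger0_norm (x := t - s)) // subr_ge0.
- exact: negligible_set0.
- move=> t xty _; rewrite -(addNr k); apply: straddleD.
    apply: straddle_le (u_straddle i_n ax xty).
    by rewrite lerN2 hk.
  move=> e e0; exists 1 => // s v xs st tv vy _.
  by rewrite -mulrBr ler_wpM2r //; lra.
Qed.

Lemma u_homo i (x y : R) : (i < n.+1)%N -> a <= x -> x <= y -> u i y <= u i x.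
Proof.
move=> i_n ax xy; have := @drop_ge i 0 x y i_n ax xy; rewrite mul0r subr_ge0; apply.
by move=> t /andP[xt _]; apply: u_ge0 => //; lra.
Qed.

(** As [u i.+1] is nonincreasing, over a step of length [d] the function [u i] loses at least [d]
    times the value of [u i.+1] at the right end. The induction stops at [i = n]: the sign
    conditions give no monotonicity of [u n.+1]. *)
Lemma iterated_drop i (r r' d : R) : (i < n.+1)%N -> a <= r -> 0 < d ->
  r + n.+1%:R * d <= r' ->
  (u i (r + i%:R * d) - u i r') * d ^+ i <= u 0 r - u 0 r'.
Proof.
move=> + ar d0 hr'; elim: i => [|i IH] i_n.
  by rewrite mul0r addr0 expr0 mulr1.
have {}IH := IH (ltnW i_n).
have id0 : 0 <= i%:R * d by rewrite mulr_ge0 // ltW.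
have hi : r + i.+1%:R * d <= r'.
  by apply: le_trans hr'; rewrite lerD2l ler_pM2r // ler_nat ltnW.
have hi' : r + i.+1%:R * d = r + i%:R * d + d by rewrite -natr1 mulrDl mul1r addrA.
have := @drop_ge i (u i.+1 (r + i.+1%:R * d)) (r + i%:R * d) (r + i.+1%:R * d) (ltnW i_n).
rewrite hi' in hi *; rewrite [_ + d - _]addrAC subrr add0r => H.
have {}H : u i.+1 (r + i%:R * d + d) * d <= u i (r + i%:R * d) - u i (r + i%:R * d + d).
  by apply: H; [lra | lra | move=> t ht; apply: u_homo => //; lra].
have h1 : u i r' <= u i (r + i%:R * d + d) by apply: u_homo; [exact: ltnW|lra|lra].
have h2 : 0 <= u i.+1 r' * d by apply: mulr_ge0; [apply: u_ge0; [exact: ltnW|lra]|lra].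
have dn : 0 <= d ^+ i by rewrite exprn_ge0 // ltW.
apply: le_trans IH; rewrite exprS mulrA ler_wpM2r //.
by rewrite mulrBl; lra.
Qed.

Local Notation F := (primitive a (fun x => x ^+ m.-1 * ffun_coef a sigma m q b x)).
Local Notation B i r r' := (fine (ess_sup_on `[r, r'] (b i))).

Lemma ess_sup_itv_fin i (r r' : R) : (1 <= i < m)%N -> a <= r -> r < r' ->
  ess_sup_on `[r, r'] (b i) = (B i r r')%:E /\ 0 <= B i r r'.
Proof.
move=> him ar rr'; apply: (ess_sup_on_fin (d := r') (bL him) (b0 him) ar _ rr') => //.
by move=> t; rewrite /= !in_itv /=; lra.
Qed.

(** Since [r' < sigma * r], the window of every [t] in [[r, r']] contains all of [[r, r']]. This is
    the purpose of the windows in [f]. *)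
Lemma ess_sup_itv_le_window i (r t r' : R) : (1 <= i < m)%N -> a <= r -> r < r' ->
  r' < sigma * r -> r <= t <= r' ->
  B i r r' <= fine (ess_sup_on (`]t / sigma, t * sigma[ `&` `[a, +oo[) (b i)).
Proof.
move=> him ar rr' r's /andP[rt tr'].
have [E1 _] := ess_sup_itv_fin him ar rr'.
have at_ : a <= t by lra.
have [E2 _] := ess_sup_window_fin a0 s1 at_ (bL him) (b0 him).
rewrite -lee_fin -E1 -E2; apply: ess_sup_onS => x; rewrite /= !in_itv /= => /andP[rx xr'].
have s1' := s1; have a0' := a0.
split; last lra; apply/andP; split.
  by rewrite ltr_pdivrMr; [nra | lra].
by nra.
Qed.

(** The first factor is at most the denominator of [f] at [t], because [d <= r <= t] and the window
    at [t] contains [[r, r']]. *)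
Lemma weight_le (r t r' d : R) : a <= r -> r < r' -> r' < sigma * r -> r <= t <= r' ->
  0 < d -> d <= r ->
  (1 + \sum_(1 <= i < m) B i r r' * d ^+ (m - i)) *
    (t ^+ m.-1 * ffun_coef a sigma m q b t) <= r' ^+ m.-1 * q t.
Proof.
move=> ar rr' r's rtr' d0 dr; have /andP[rt tr'] := rtr'; have a0' := a0.
have at_ : a <= t by lra.
have den1 := ffun_coef_den_ge1 a0 s1 b0 bL at_.
rewrite mulrCA; apply: ler_pM.
- by apply: exprn_ge0; lra.
- apply: mulr_ge0; last exact: ffun_coef_ge0.
  rewrite addr_ge0 // big_nat_cond sumr_ge0 // => i; rewrite andbT => him.
  by apply: mulr_ge0; [exact: (ess_sup_itv_fin him ar rr').2 | apply: exprn_ge0; lra].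
- by apply: lerXn2r; rewrite ?nnegrE; lra.
- rewrite /ffun_coef mulrA ler_pdivrMr; last exact: (lt_le_trans ltr01 den1).
  rewrite mulrC ler_wpM2l ?q0 // lerD2l big_nat_cond [X in _ <= X]big_nat_cond.
  apply: ler_sum => i; rewrite andbT => him; rewrite mulrC; apply: ler_pM.
  + by apply: exprn_ge0; lra.
  + exact: (ess_sup_itv_fin him ar rr').2.
  + by apply: lerXn2r; rewrite ?nnegrE; lra.
  + exact: ess_sup_itv_le_window.
Qed.

Local Notation W r r' d := (1 + \sum_(1 <= i < m) B i r r' * d ^+ (m - i)).
Local Notation Z r r' t := (u n.+1 t + \sum_(1 <= i < m) B i r r' * u i.-1 t).

Lemma W_ge1 (r r' d : R) : a <= r -> r < r' -> 0 < d -> 1 <= W r r' d.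
Proof.
move=> ar rr' d0; rewrite lerDl big_nat_cond sumr_ge0 // => i; rewrite andbT => him.
by apply: mulr_ge0; [exact: (ess_sup_itv_fin him ar rr').2 | rewrite exprn_ge0 // ltW].
Qed.

(* Adding [B i * u i.-1] to the last derivative absorbs the lower order terms
   of the equation. *)
Lemma energy_drop (r r' d gam x y : R) : a <= r -> r < r' -> r' < sigma * r ->
  0 < d -> d <= r -> 0 < gam -> (forall t, r <= t <= r' -> gam <= h (u 0 t)) ->
  r <= x -> x <= y -> y <= r' ->
  gam * W r r' d / r' ^+ m.-1 * (F y - F x) <= Z r r' x - Z r r' y.
Proof.
move=> ar rr' r's d0 dr gam0 hgam rx xy yr'.
have a0' := a0; have r'0 : 0 < r' ^+ m.-1 by apply: exprn_gt0; lra.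
have W1 := W_ge1 ar rr' d0.
(* Chosen so that [weight_le] and [gam <= h] give [c * t^(m-1) * f t <= q t * h (u 0 t)]; then
   [Z / c] decreases at least as fast as [F] grows. *)
set c := gam * _ / _.
have c0 : 0 < c by apply: divr_gt0 => //; apply: mulr_gt0 => //; exact: lt_le_trans ltr01 W1.
have ax : a <= x by lra.
rewrite mulrC -ler_pdivlMr // -lee_fin.
(* Index 0 carries the differential inequality and index [i.+1] the bound on [b i], so that one null
   set serves for all of them. *)
pose P k t := if k is i.+1 then (1 <= i < m)%N -> r <= t <= r' -> b i t <= B i r r'
  else a <= t -> forall c d, a <= c -> c <= t <= d ->
  straddle c d (u n.+1) (- (q t * h (u 0 t)) + \sum_(1 <= i < m) b i t * u i t) t.
have aeP : {ae mu, forall t k, P k t}.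
  apply: ae_foralln => -[|i]; first exact: u_last.
  have [him|him] := boolP (1 <= i < m)%N; last first.
    by apply: nearW => t /= him'; rewrite him' in him.
  have [E _] := ess_sup_itv_fin him ar rr'.
  have : (ess_sup_on `[r, r'] (b i) <= (B i r r')%:E)%E by rewrite -E.
  move/ess_sup_on_leP; apply: ae_mono => t ht _ rtr'; apply: ht.
  by rewrite /= in_itv.
have q0' := ffun_coef_ge0 a0 s1 q0 b0 bL.
have w0 := weight_ge0 a0 s1 q0 b0 bL.
have mw := lmeasurable_weight a0 s1 qL b0 bL.
have bw := weight_bounded a0 s1 q0 qL b0 bL.
apply: le_trans (primitive_sub w0 mw bw ax xy) _.
rewrite (_ : (Z r r' x - Z r r' y) / c = c^-1 * Z r r' x - c^-1 * Z r r' y); last first.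
  by rewrite -mulrBr mulrC.
apply: (abs_continuous_integral_le (z := fun t => c^-1 * Z r r' t) xy _ _ aeP).
- apply: abs_continuousZ; apply: abs_continuousD; first exact: u_abs_continuous.
  rewrite [X in abs_continuous _ _ X](_ : _ = fun t =>
    \sum_(i <- index_iota 1 m | (1 <= i < m)%N) B i r r' * u i.-1 t); last first.
    by apply/funext => t; rewrite big_nat_cond; apply: eq_bigl => i; rewrite andbT.
  apply: abs_continuous_sum => i him; apply: abs_continuousZ.
  by apply: u_abs_continuous => //; exact: pred_ltm.
- by move=> t /andP[xt _]; apply: w0; lra.
move=> t xty; rewrite /setC /= => /contrapT hP; have /andP[xt ty] := xty.
have rtr' : r <= t <= r' by lra.
have at_ : a <= t by lra.
have S : straddle x y (fun v => Z r r' v)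
   (- (q t * h (u 0 t)) + \sum_(1 <= i < m) b i t * u i t
   + \sum_(i <- index_iota 1 m | (1 <= i < m)%N) B i r r' * - u i t) t.
  apply: straddleD; first exact: (hP 0%N at_ x y ax xty).
  rewrite [X in straddle _ _ X](_ : _ = fun t =>
    \sum_(i <- index_iota 1 m | (1 <= i < m)%N) B i r r' * u i.-1 t); last first.
    by apply/funext => v; rewrite big_nat_cond; apply: eq_bigl => i; rewrite andbT.
  apply: straddle_sum => i him; apply: straddleZ.
    exact: (ess_sup_itv_fin him ar rr').2.
  by case: i him => // i him; exact: (u_straddle (pred_lt him) ax xty).
have cV : 0 <= c^-1 by rewrite invr_ge0 ltW.
apply: straddle_le (straddleZ cV S).
rewrite -(ler_pM2l c0) mulrA divff ?gt_eqF // mul1r mulrN.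
have h1 : c * (t ^+ m.-1 * ffun_coef a sigma m q b t) <= q t * h (u 0 t).
  have := weight_le ar rr' r's rtr' d0 dr.
  rewrite mulrC -ler_pdivlMr ?(lt_le_trans ltr01 W1) // => hw.
  apply: le_trans (ler_wpM2l (ltW c0) hw) _.
  rewrite (_ : c * _ = gam * q t).
    by rewrite mulrC; apply: ler_wpM2l; [exact: q0 | exact: hgam].
  rewrite /c; field; rewrite -/(1 + _) gt_eqF ?(lt_le_trans ltr01 W1) //=.
  by rewrite -[X in X != 0]/(r' ^+ m.-1) gt_eqF.
have h2 : \sum_(1 <= i < m) b i t * u i t
   + \sum_(i <- index_iota 1 m | (1 <= i < m)%N) B i r r' * - u i t <= 0.
  rewrite big_nat_cond (eq_bigl (fun i => (1 <= i < m)%N)); last by move=> i; rewrite andbT.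
  rewrite -big_split /=; apply: sumr_le0 => i him.
  rewrite mulrN -mulrBl; apply: mulr_le0_ge0.
    by rewrite subr_le0; exact: (hP i.+1).
  by apply: u_ge0 => //; case/andP: him.
by lra.
Qed.

(** The growth of [F] over [[s, r']] forces [u n.+1] to be large on a stretch of length [d] before
    [s], up to the drops of the lower [u i]. The [n] steps before this stretch turn this into a drop
    of [u 0]. *)
Lemma interval_estimate (r r' s d gam : R) : a <= r -> 0 < d -> d <= r ->
  r + n.+1%:R * d <= s -> s <= r' -> r' < sigma * r ->
  0 < gam -> (forall t, r <= t <= r' -> gam <= h (u 0 t)) ->
  gam * d ^+ m.-1 * (F r' - F s) <= r' ^+ m.-1 * (u 0 r - u 0 r').
Proof.
move=> ar d0 dr rs sr' r's gam0 hgam.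
have nd0 : 0 < n.+1%:R * d by rewrite mulr_gt0.
have nd1 : 0 <= n%:R * d by rewrite mulr_ge0 // ltW.
have ndE : n.+1%:R * d = n%:R * d + d by rewrite -natr1 mulrDl mul1r.
have rr' : r < r' by lra.
have a0' := a0; have r'0 : 0 < r' ^+ m.-1 by apply: exprn_gt0; lra.
set D := u 0 r - u 0 r'.
have dK i : 0 < d ^+ i by rewrite exprn_gt0.
set c := gam * W r r' d / r' ^+ m.-1.
have W1 := W_ge1 ar rr' d0.
have c0 : 0 < c by apply: divr_gt0 => //; apply: mulr_gt0 => //; exact: lt_le_trans ltr01 W1.
have hE x : r <= x -> x <= s -> c * (F r' - F s) <= Z r r' x - Z r r' r'.
  move=> rx xs.
  have h1 := energy_drop ar rr' r's d0 dr gam0 hgam rx xs sr'.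
  have rs' : r <= s by lra.
  have h2 := energy_drop ar rr' r's d0 dr gam0 hgam rs' sr' (lexx r').
  rewrite -/c in h1 h2.
  have ax : a <= x by lra.
  have : 0 <= c * (F s - F x).
    apply: mulr_ge0; first exact: ltW.
    by rewrite subr_ge0 (primitive_homo (weight_ge0 a0 s1 q0 b0 bL)
      (lmeasurable_weight a0 s1 qL b0 bL) (weight_bounded a0 s1 q0 qL b0 bL)).
  by lra.
(* The subtracted sum bounds the part of the drop of [Z] due to the [u i.-1], each estimated by
   [iterated_drop] after [i.-1] steps. *)
pose K := c * (F r' - F s) - \sum_(1 <= i < m) B i r r' * (D / d ^+ i.-1).
have hK x : r + n%:R * d <= x -> x <= r + n.+1%:R * d -> K <= u n.+1 x.
  move=> rx xr; have rx' : r <= x by lra.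
  have xs : x <= s by lra.
  have := hE x rx' xs.
  have hu : 0 <= u n.+1 r' by apply: u_ge0 => //; lra.
  have hS : \sum_(1 <= i < m) B i r r' * u i.-1 x - \sum_(1 <= i < m) B i r r' * u i.-1 r'
      <= \sum_(1 <= i < m) B i r r' * (D / d ^+ i.-1).
    rewrite -sumrB big_nat_cond [X in _ <= X]big_nat_cond; apply: ler_sum => i.
    rewrite andbT => him; rewrite -mulrBr; apply: ler_wpM2l.
      exact: (ess_sup_itv_fin him ar rr').2.
    rewrite ler_pdivlMr //.
    have i_n := pred_lt him.
    have rd : r + n.+1%:R * d <= r' by lra.
    apply: le_trans (iterated_drop i_n ar d0 rd).
    rewrite ler_pM2r // lerD2r; apply: u_homo => //.
      have : 0 <= i.-1%:R * d by rewrite mulr_ge0 // ltW.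
      by lra.
    by apply: le_trans rx; rewrite lerD2l ler_pM2r // ler_nat -ltnS.
  by rewrite /K; lra.
have ar' : a <= r + n%:R * d by lra.
have rr : r + n%:R * d <= r + n.+1%:R * d by lra.
have hd := @drop_ge n K (r + n%:R * d) (r + n.+1%:R * d) (ltnSn n) ar' rr.
have {}hd : K * d <= u n (r + n%:R * d) - u n r'.
  have : u n r' <= u n (r + n.+1%:R * d) by apply: u_homo => //; lra.
  have : K * (r + n.+1%:R * d - (r + n%:R * d)) <= u n (r + n%:R * d) - u n (r + n.+1%:R * d).
    by apply: hd => t /andP[h1 h2]; exact: hK.
  by rewrite ndE (_ : r + (n%:R * d + d) - (r + n%:R * d) = d); [lra | ring].
have rd : r + n.+1%:R * d <= r' by lra.
have hD := iterated_drop (ltnSn n) ar d0 rd.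
have hKd : K * d ^+ n.+1 <= D.
  by rewrite exprS mulrA; apply: le_trans hD; rewrite ler_pM2r.
(* As [d^(m-1) / d^(i-1) = d^(m-i)], the subtracted sum is [D * (W - 1)]. Moved to the other side it
   makes [D * W], and [W] cancels against the factor in [c]. *)
have KE : K * d ^+ n.+1 = c * (F r' - F s) * d ^+ n.+1 - D * (W r r' d - 1).
  rewrite /K mulrBl; congr (_ - _).
  rewrite [1 + _]addrC addrK mulr_suml mulr_sumr big_nat_cond [RHS]big_nat_cond.
  apply: eq_bigr => i; rewrite andbT => him.
  have -> : d ^+ n.+1 = d ^+ i.-1 * d ^+ (m - i).
    by rewrite -exprD pred_sub.
  by field; rewrite gt_eqF.
rewrite KE in hKd.
have {}hKd : c * (F r' - F s) * d ^+ n.+1 <= D * W r r' d by lra.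
have W0 : 0 < W r r' d by exact: lt_le_trans ltr01 W1.
rewrite -(ler_pM2r W0) [X in _ <= X](_ : _ = (D * W r r' d) * r' ^+ m.-1); last by ring.
rewrite -ler_pdivrMr //; apply: le_trans hKd.
rewrite le_eqVlt; apply/orP; left; apply/eqP; rewrite /c.
set Y := W r r' d; set V := r' ^+ m.-1; set G := F r' - F s.
have V0 : V != 0 by rewrite gt_eqF.
by rewrite /=; field.
Qed.

End IntervalEstimate.

(** * Growth of the primitive *)

Section Root.
Context {R : realType} (n : nat).
Implicit Types x y z p : R.

(** The order is [n.+1]; the later sections use [root n.+1], whose order is [m = n.+2]. *)
Definition root x : R := x `^ (n.+1%:R^-1).

Lemma root_ge0 x : 0 <= root x. Proof. exact: powR_ge0. Qed.

Lemma rootK x : 0 <= x -> root x ^+ n.+1 = x.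
Proof.
by move=> x0; rewrite /root -powR_mulrn ?powR_ge0 // -powRrM mulVf ?pnatr_eq0 // powRr1.
Qed.

Lemma le_rootP x y : 0 <= x -> 0 <= y -> (root x <= root y) = (x <= y).
Proof.
by move=> x0 y0; rewrite -{2}(rootK x0) -{2}(rootK y0) ler_pXn2r // nnegrE root_ge0.
Qed.

Lemma rootM x y : 0 <= x -> 0 <= y -> root (x * y) = root x * root y.
Proof. by move=> x0 y0; rewrite /root powRM. Qed.

Lemma root_exp x : 0 <= x -> root (x ^+ n.+1) = x.
Proof.
by move=> x0; rewrite /root -powR_mulrn // -powRrM mulfV ?pnatr_eq0 // powRr1.
Qed.

Lemma root_gt0 x : 0 < x -> 0 < root x. Proof. exact: powR_gt0. Qed.

Lemma root_div x y : 0 <= x -> 0 < y -> root (x / y) = root x / root y.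
Proof.
move=> x0 y0; have y0' : y != 0 by rewrite gt_eqF.
have ry0 : root y != 0 by rewrite gt_eqF // root_gt0.
by rewrite -[in RHS](divfK y0' x) [in RHS]rootM ?mulfK // ?divr_ge0 // ltW.
Qed.

Lemma root_divx x : 0 < x -> root x / x = (root x ^+ n)^-1.
Proof.
move=> x0; rewrite -[in X in _ / X](rootK (ltW x0)) exprS invfM mulrA mulfV ?mul1r //.
by rewrite gt_eqF // root_gt0.
Qed.

Lemma exprD_ge x y k : 0 <= x -> 0 <= y -> x ^+ k.+1 + y ^+ k.+1 <= (x + y) ^+ k.+1.
Proof.
move=> x0 y0; elim: k => [|k IH]; first by rewrite !expr1.
have IH' := ler_wpM2l (addr_ge0 x0 y0) IH.
rewrite [X in _ <= X]exprS; apply: le_trans IH'.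
have h1 : 0 <= x * y ^+ k.+1 by rewrite mulr_ge0 ?exprn_ge0.
have h2 : 0 <= y * x ^+ k.+1 by rewrite mulr_ge0 ?exprn_ge0.
by rewrite !(exprS _ k.+1) mulrDl !mulrDr; lra.
Qed.

Lemma root_le_add x y z : 0 <= x -> 0 <= y -> 0 <= z -> z <= x + y ->
  root z <= root x + root y.
Proof.
move=> x0 y0 z0 zxy; have rx := root_ge0 x; have ry := root_ge0 y.
rewrite -[X in _ <= X]root_exp ?addr_ge0 // le_rootP ?exprn_ge0 ?addr_ge0 //.
apply: le_trans zxy _; rewrite -{1}(rootK x0) -{1}(rootK y0).
exact: exprD_ge.
Qed.

End Root.

Lemma powers_unbounded {R : realType} (lambda r r' : R) : 1 < lambda -> 0 < r ->
  exists k, r' <= lambda ^+ k.+1 * r.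
Proof.
move=> l1 r0; have lm0 : 0 < lambda - 1 by rewrite subr_gt0.
have bern k : 1 + k%:R * (lambda - 1) <= lambda ^+ k.
  elim: k => [|k IH]; first by rewrite mul0r addr0 expr0.
  rewrite exprSr -natr1; apply: le_trans (ler_wpM2r (ltW (lt_trans ltr01 l1)) IH).
  rewrite -subr_ge0.
  have -> : (1 + k%:R * (lambda - 1)) * lambda - (1 + (k%:R + 1) * (lambda - 1)) =
    k%:R * (lambda - 1) ^+ 2 by ring.
  by rewrite mulr_ge0 // exprn_ge0 // ltW.
exists (Num.truncn (r' / (r * (lambda - 1)))).+1.
have h := truncnS_gt (r' / (r * (lambda - 1))).
set K := _.+1 in h *.
have rl0 : 0 < r * (lambda - 1) by exact: mulr_gt0.
rewrite ltr_pdivrMr // in h; apply: le_trans (ltW h) _.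
rewrite mulrCA mulrC ler_pM2r //; apply: le_trans (bern K.+1).
by rewrite -natr1 mulrDl mul1r; lra.
Qed.

Section Growth.
Context {R : realType}.
Variables (a sigma lambda C R0 : R) (n : nat) (F v w : R -> R).
Local Notation m := n.+2.
Local Notation root := (root n.+1).
Hypothesis a0 : 0 < a.
Hypotheses (l1 : 1 < lambda) (l2 : lambda <= 2) (lsigma : lambda ^+ 2 < sigma).
Hypotheses (C0 : 0 < C) (aR0 : a <= R0) (FR0 : 0 < F R0).
Hypothesis F_homo : forall x y, a <= x -> x <= y -> F x <= F y.
(** The limsup hypothesis, integrated over [[x, y]]. *)
Hypothesis F_growth : forall x y, R0 <= x -> x <= y -> F y - F x <= C * F y * (y - x) / x.
Hypothesis w_homo : forall x y, a <= x -> x <= y -> w y <= w x.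
(* [v] plays the role of [h \o w]. *)
Hypothesis step : forall r r' s d gam, a <= r -> 0 < d -> d <= r ->
  r + n.+1%:R * d <= s -> s <= r' -> r' < sigma * r ->
  0 < gam -> (forall t, r <= t <= r' -> gam <= v t) ->
  gam * d ^+ n.+1 * (F r' - F s) <= r' ^+ n.+1 * (w r - w r').

(** Makes [F] grow by at most a quarter of its increment during the [n.+1] steps of length [d]. In
    [c1], one factor 2 comes from discarding that part of the increment, the inner one from
    [r' <= 2 * r]. *)
Let kappa : R := 4 * C * n.+1%:R.
Let c1 : R := 2 * (2 * kappa) ^+ n.+1.

Lemma short_step (r r' gam : R) : R0 <= r -> r <= r' -> r' <= lambda * r -> 0 < gam ->
  (forall t, r <= t <= r' -> gam <= v t) ->
  root (F r') <= root (F r) + root (c1 * ((w r - w r') / gam)).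
Proof.
move=> R0r rr' r'l gam0 hv.
have kE : kappa = 4 * C * n.+1%:R by [].
have cE : c1 = 2 * (2 * kappa) ^+ n.+1 by [].
clearbody c1; clearbody kappa.
have a0' := a0; have aR0' := aR0; have l1' := l1; have l2' := l2.
have C0' := C0; have r0 : 0 < r by lra.
have n0 : 0 < n.+1%:R :> R by rewrite ltr0n.
have k0 : 0 < kappa by rewrite kE !mulr_gt0.
have ar : a <= r by lra.
have Fr : 0 < F r by apply: lt_le_trans FR0 (F_homo aR0 R0r).
have FF : F r <= F r' by apply: F_homo.
have Fr' : 0 < F r' by lra.
have D0 : 0 <= w r - w r' by rewrite subr_ge0 w_homo.
have [->|neq] := eqVneq (F r') (F r); first by rewrite lerDl root_ge0.
set dF := F r' - F r; have dF0 : 0 < dF by rewrite subr_gt0 lt_neqAle eq_sym neq.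
(* The growth bound on [dF] makes [n.+1] steps of this length fit into a quarter of [[r, r']]. *)
pose d := r * dF / (kappa * F r').
have kF0 : 0 < kappa * F r' by exact: mulr_gt0.
have d0 : 0 < d by apply: divr_gt0 => //; exact: mulr_gt0.
have ndE : n.+1%:R * d = r * dF / (4 * C * F r').
  by rewrite /d kE; field; rewrite !gt_eqF.
have nd_le : 4 * (n.+1%:R * d) <= r' - r.
  have : dF <= C * F r' * (r' - r) / r by apply: F_growth.
  rewrite ler_pdivlMr // => h; rewrite ndE.
  have CF0 : 0 < C * F r' by exact: mulr_gt0.
  rewrite (_ : 4 * _ = dF * r / (C * F r')); last by field; rewrite !gt_eqF.
  by rewrite ler_pdivrMr // [X in _ <= X]mulrC.
have d_le : d <= n.+1%:R * d by rewrite ler_peMl ?ler1n // ltW.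
have lr2 : lambda * r <= 2 * r by rewrite ler_pM2r.
have ls : lambda < sigma.
  by apply: le_lt_trans lsigma; rewrite expr2 ler_peMl //; lra.
have r's : r' < sigma * r by apply: le_lt_trans r'l _; rewrite ltr_pM2r.
have dr : d <= r by lra.
have sr' : r + n.+1%:R * d <= r' by lra.
have := step ar d0 dr (lexx _) sr' r's gam0 hv.
set s := r + n.+1%:R * d.
have Fs : F s - F r <= dF / 4.
  have h1 : F s - F r <= C * F s * (s - r) / r by apply: F_growth => //; rewrite /s; lra.
  apply: le_trans h1 _.
  have -> : dF / 4 = C * F r' * (s - r) / r.
    by rewrite /s (addrC r) addrK ndE; field; rewrite !gt_eqF.
  rewrite ler_pM2r ?invr_gt0 // ler_wpM2r //; first by rewrite /s; lra.
  by rewrite ler_pM2l //; apply: F_homo => //; rewrite /s; lra.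
have Fs2 : dF / 2 <= F r' - F s by move: Fs; rewrite /dF; lra.
move=> hstep.
have gd0 : 0 < gam * d ^+ n.+1 by rewrite mulr_gt0 // exprn_gt0.
have {hstep} : gam * d ^+ n.+1 * (dF / 2) <= (2 * r) ^+ n.+1 * (w r - w r').
  apply: (le_trans (ler_wpM2l (ltW gd0) Fs2)); apply: le_trans hstep _.
  by rewrite ler_wpM2r //; apply: lerXn2r; rewrite ?nnegrE; lra.
rewrite /d expr_div_n !exprMn => hstep.
have hstep2 : gam * dF ^+ m <= 2 * (2 * kappa) ^+ n.+1 * (w r - w r') * F r' ^+ n.+1.
  have rn0 : 0 < r ^+ n.+1 by exact: exprn_gt0.
  have kn0 : 0 < kappa ^+ n.+1 by exact: exprn_gt0.
  have Fn0 : 0 < F r' ^+ n.+1 by exact: exprn_gt0.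
  have P0 : 0 < r ^+ n.+1 / (2 * kappa ^+ n.+1 * F r' ^+ n.+1).
    by rewrite divr_gt0 // !mulr_gt0.
  rewrite -(ler_pM2l P0) exprMn [dF ^+ m]exprS.
  apply: le_trans (le_trans hstep _).
    by rewrite le_eqVlt; apply/orP; left; apply/eqP; field; rewrite !gt_eqF.
  by rewrite le_eqVlt; apply/orP; left; apply/eqP; field; rewrite !gt_eqF.
have q0 := root_ge0 n.+1 (F r); have p0 := root_ge0 n.+1 (F r').
set p := root (F r') in p0 *; set q := root (F r) in q0 *.
have qp : q <= p by rewrite le_rootP // ltW.
rewrite -lerBlDl -[X in X <= _](@root_exp _ n.+1) ?subr_ge0 //.
rewrite le_rootP ?exprn_ge0 ?subr_ge0 //; last first.
  rewrite mulr_ge0 //; last by rewrite divr_ge0 // ltW.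
  by rewrite cE mulr_ge0 // exprn_ge0 // mulr_ge0 // ltW.
rewrite mulrA ler_pdivlMr // cE.
have pE : p ^+ m = F r' by rewrite rootK // ltW.
have qE : q ^+ m = F r by rewrite rootK // ltW.
have Fn0 : 0 < F r' ^+ n.+1 by exact: exprn_gt0.
rewrite -(ler_pM2r Fn0); apply: le_trans hstep2.
rewrite -mulrA [X in X <= _]mulrCA ler_pM2l // mulrC.
(* What remains is the power of order [m] of [(p - q) * p^(m-1) <= p^m - q^m], which holds because
   [q <= p]. *)
have -> : F r' ^+ n.+1 = (p ^+ n.+1) ^+ m by rewrite -pE -!exprM mulnC.
rewrite -exprMn; apply: lerXn2r; rewrite ?nnegrE; [|exact: ltW|].
  by rewrite mulr_ge0 ?exprn_ge0 ?subr_ge0.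
rewrite /dF -pE -qE mulrBr -exprSr lerD2l lerN2 exprSr.
by rewrite ler_wpM2r //; apply: lerXn2r; rewrite ?nnegrE.
Qed.

Let c2 : R := (lambda ^+ 2 * n.+1%:R / (lambda - 1)) ^+ n.+1.

Let c2_ge0 : 0 <= c2.
Proof.
have l1' := l1; rewrite exprn_ge0 // divr_ge0 //; last lra.
by rewrite mulr_ge0 // exprn_ge0 //; lra.
Qed.

(** With [d] a fixed proportion of [r], the ratio of [r'] to [d] is bounded, and [c2] is the
    resulting bound on its power. The condition [lambda^2 < sigma] is what admits two consecutive
    ratios. *)
Lemma two_step (r r' gam : R) : a <= r -> lambda * r <= r' -> r' <= lambda ^+ 2 * r ->
  0 < gam -> (forall t, r <= t <= r' -> gam <= v t) ->
  gam * (F r' - F (lambda * r)) <= c2 * (w r - w r').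
Proof.
move=> ar lr r'l gam0 hv.
have cE : c2 = (lambda ^+ 2 * n.+1%:R / (lambda - 1)) ^+ n.+1 by [].
have a0' := a0; have l1' := l1; have l2' := l2; have r0 : 0 < r by lra.
have n0 : 0 < n.+1%:R :> R by rewrite ltr0n.
have lm0 : 0 < lambda - 1 by lra.
pose d := (lambda - 1) * r / n.+1%:R.
have d0 : 0 < d by rewrite divr_gt0 // mulr_gt0.
have ndE : n.+1%:R * d = lambda * r - r by rewrite /d; field; rewrite gt_eqF.
have d_le : d <= n.+1%:R * d by rewrite ler_peMl ?ler1n // ltW.
have lr2 : lambda * r <= 2 * r by rewrite ler_pM2r.
have dr : d <= r by lra.
have rs : r + n.+1%:R * d <= lambda * r by rewrite ndE; lra.
have r's : r' < sigma * r by apply: le_lt_trans r'l _; rewrite ltr_pM2r.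
have h := step ar d0 dr rs lr r's gam0 hv.
have rr' : r <= r' by lra.
have D0 : 0 <= w r - w r' by rewrite subr_ge0 w_homo.
have dn0 : 0 < d ^+ n.+1 by exact: exprn_gt0.
rewrite -(ler_pM2l dn0) mulrCA mulrA; apply: le_trans h _.
rewrite mulrA; apply: ler_wpM2r => //.
have -> : d ^+ n.+1 * c2 = (lambda ^+ 2 * r) ^+ n.+1.
  by rewrite cE -exprMn /d; congr (_ ^+ _); field; rewrite !gt_eqF.
by apply: lerXn2r; rewrite ?nnegrE; lra.
Qed.

(* Drops over two consecutive steps are used so that each endpoint is at a
   fixed proportion from the start; every drop is thus counted twice. *)
Lemma many_steps k (r r' gam : R) : a <= r -> lambda * r <= r' ->
  r' <= lambda ^+ k.+1 * r -> 0 < gam -> (forall t, r <= t <= r' -> gam <= v t) ->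
  gam * (F r' - F (lambda * r)) <= c2 * ((w r - w r') + (w (lambda * r) - w r')).
Proof.
have l1' := l1; have a0' := a0.
elim: k r => [|k IH] r ar lr r'l gam0 hv.
all: have r0 : 0 < r by lra.
all: have rlr : r <= lambda * r by rewrite ler_peMl //; lra.
all: have D0 : 0 <= w (lambda * r) - w r' by rewrite subr_ge0 w_homo //; lra.
all: have D1 : 0 <= w r - w r' by rewrite subr_ge0 w_homo //; lra.
  rewrite expr1 in r'l; have -> : r' = lambda * r by apply/eqP; rewrite eq_le r'l lr.
  rewrite subrr mulr0 mulr_ge0 //; apply: addr_ge0; rewrite subr_ge0 w_homo //; lra.
have [h|h] := leP r' (lambda ^+ 2 * r).
  apply: le_trans (two_step ar lr h gam0 hv) _.
  by rewrite ler_wpM2l // lerDl.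
have llr : lambda * r <= lambda * (lambda * r) by rewrite ler_peMl //; lra.
have hl : lambda * (lambda * r) = lambda ^+ 2 * r by rewrite mulrA -expr2.
have h1 : gam * (F (lambda ^+ 2 * r) - F (lambda * r)) <= c2 * (w r - w (lambda ^+ 2 * r)).
  apply: two_step => //; first by rewrite -hl.
  by move=> t ht; apply: hv; lra.
have h2 := IH (lambda * r).
rewrite hl in h2; have {}h2 : gam * (F r' - F (lambda ^+ 2 * r)) <=
    c2 * (w (lambda * r) - w r' + (w (lambda ^+ 2 * r) - w r')).
  apply: h2 => //; [lra | lra | by rewrite mulrA -exprSr | ].
  by move=> t ht; apply: hv; lra.
have -> : gam * (F r' - F (lambda * r)) = gam * (F (lambda ^+ 2 * r) - F (lambda * r)) +
  gam * (F r' - F (lambda ^+ 2 * r)) by ring.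
apply: le_trans (lerD h1 h2) _.
by rewrite -mulrDr le_eqVlt; apply/orP; left; apply/eqP; ring.
Qed.

Definition growth_const : R := root c1 + root (2 * c2).

Lemma growth_const_ge0 : 0 <= growth_const.
Proof. by rewrite addr_ge0 ?root_ge0. Qed.

(** [short_step] covers the part up to [lambda * r], and [many_steps] the rest, where twice the
    total drop is at most [2 * T]. Subadditivity of the root joins the two contributions, one for
    each term of [growth_const]. *)
Lemma block_growth (r r' gam T : R) : R0 <= r -> r <= r' -> 0 < gam ->
  (forall t, r <= t <= r' -> gam <= v t) -> w r <= T -> 0 <= w r' ->
  root (F r') <= root (F r) + growth_const * root (T / gam).
Proof.
move=> R0r rr' gam0 hv wT w0.
have a0' := a0; have l1' := l1; have aR0' := aR0; have FR0' := FR0.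
have r0 : 0 < r by lra.
have ar : a <= r by lra.
have rlr : r <= lambda * r by rewrite ler_peMl //; lra.
have F0 x : R0 <= x -> 0 <= F x by move=> hx; apply: le_trans (ltW FR0) (F_homo aR0 hx).
have D0 : 0 <= w r - w r' by rewrite subr_ge0 w_homo.
have T0 : 0 <= T by lra.
have Tg : 0 <= T / gam by rewrite divr_ge0 // ltW.
have c10 : 0 <= c1.
  by rewrite /c1 /kappa mulr_ge0 // exprn_ge0 // !mulr_ge0 // ltW.
have c20 : 0 <= 2 * c2 by rewrite mulr_ge0.
have hshort x : r <= x -> x <= r' -> x <= lambda * r ->
    root (F x) <= root (F r) + root c1 * root (T / gam).
  move=> rx xr' xl.
  have hvx t : r <= t <= x -> gam <= v t by move=> ht; apply: hv; lra.
  have hs := short_step R0r rx xl gam0 hvx.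
  have wx : 0 <= w r - w x by rewrite subr_ge0 w_homo.
  have wx' : w r' <= w x by apply: w_homo => //; lra.
  apply: le_trans hs _.
  have wg : 0 <= (w r - w x) / gam by rewrite divr_ge0 // ltW.
  rewrite lerD2l -rootM // le_rootP; [|exact: mulr_ge0|exact: mulr_ge0].
  by rewrite ler_wpM2l // ler_pM2r ?invr_gt0 //; lra.
rewrite /growth_const mulrDl.
have q0 : 0 <= root (2 * c2) * root (T / gam) by rewrite mulr_ge0 ?root_ge0.
have [h|h] := leP r' (lambda * r).
  by apply: le_trans (hshort r' rr' (lexx _) h) _; rewrite addrA lerDl.
have [k hk] := powers_unbounded r' l1 r0.
have hm := many_steps ar (ltW h) hk gam0 hv.
have hl := hshort (lambda * r) rlr (ltW h) (lexx _).
have wl : w (lambda * r) <= w r by apply: w_homo.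
have hF : F r' <= F (lambda * r) + 2 * c2 * (T / gam).
  rewrite -lerBlDl mulrA ler_pdivlMr // mulrC; apply: le_trans hm _.
  rewrite -mulrA mulrCA ler_wpM2l //; lra.
have := @root_le_add _ n.+1 (F (lambda * r)) (2 * c2 * (T / gam)) (F r') (F0 _ _)
  (mulr_ge0 c20 Tg) (F0 _ _) hF.
rewrite rootM // => h3; have {}h3 := h3 ltac:(lra) ltac:(lra).
by lra.
Qed.

End Growth.

(** * Descent of the solution to zero *)

Section StepIntegral.
Context {R : realType}.
Local Notation mu := (leb R).
Import HBNNSimple.

Lemma integral_ge_steps (D : set R) (G : R -> R) (c x y : nat -> R) (k : nat) :
  (forall t, D t -> 0 <= G t) -> (forall j, 0 <= c j) -> (forall j, x j <= y j) ->
  (forall j, (j < k)%N -> `]x j, y j[ `<=` D) ->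
  (forall j t, (j < k)%N -> x j < t < y j -> c j <= G t) ->
  trivIset setT (fun j => `]x j, y j[%classic) ->
  ((\sum_(j < k) c j * (y j - x j))%:E <= \int[mu]_(t in D) (G t)%:E)%E.
Proof.
move=> G0 c0 xy xyD cG tI.
have mI j : measurable (`]x j, y j[%classic : set (lebesgueType R)).
  by apply: leb_borel; exact: measurable_itv.
pose s := sum_nnsfun (fun j => scale_nnsfun (indic_nnsfun R (mI j)) (c0 j)) k.
have sE t : s t = \sum_(j < k) c j * \1_(`]x j, y j[%classic) t.
  by rewrite /s sum_nnsfunE.
rewrite ge0_integralE; last by move=> t Dt; rewrite lee_fin G0.
apply: le_ereal_sup_tmp; exists (sintegral mu s).
  exists s => // t /=; rewrite sE.
  have [[j [jk jt]]|no] := pselect (exists j, (j < k)%N /\ x j < t < y j).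
    have Dt : D t by apply: (xyD j jk); rewrite /= in_itv.
    rewrite /patch mem_set // lee_fin (bigD1 (Ordinal jk)) //= big1 ?addr0.
      by rewrite indicE mem_set ?mulr1 ?cG //= in_itv.
    move=> i ij; rewrite indicE memNset ?mulr0 // => it.
    move/eqP: ij; apply; apply: val_inj; apply: (tI i j) => //.
    by exists t; split => //=; rewrite in_itv.
  rewrite big1.
    by rewrite /patch; case: ifPn => //; rewrite inE lee_fin => /G0.
  move=> i _; rewrite indicE memNset ?mulr0 //= in_itv /= => it.
  by apply: no; exists i.
rewrite -integralT_nnsfun; under eq_integral do rewrite sE -sumEFin.
rewrite ge0_integral_sum //=.
- rewrite -sumEFin le_eqVlt; apply/orP; left; apply/eqP; apply: eq_bigr => j _.
  under eq_integral do rewrite EFinM.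
  rewrite ge0_integralZl_EFin //.
  + rewrite integral_indic // setIT EFinM; congr (_ * _)%E.
    rewrite [RHS](leb_itv `]x j, y j[) /= lte_fin; case: ifPn => //; rewrite -leNgt => yx.
    by rewrite (_ : y j - x j = 0) //; have := xy j; lra.
  + by apply/measurable_EFinP; exact: measurable_indic.
- move=> j; apply/measurable_EFinP; apply: measurable_funM; first exact: measurable_cst.
  exact: measurable_indic.
- by move=> j t _; rewrite lee_fin mulr_ge0.
Qed.

End StepIntegral.

(** Real induction on [v < z x]: if [z] never equals [v], it moves near [t] by less than [|z t - v|]
    and stays on one side of [v]. *)
Lemma abs_continuous_ivt {R : realType} (c d v : R) (z : R -> R) : c <= d ->
  abs_continuous c d z -> z d <= v -> v <= z c -> exists2 x, c <= x <= d & z x = v.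
Proof.
move=> cd ACz zd zc; apply: contrapT => no.
have zv x : c <= x <= d -> z x != v.
  by move=> cxd; apply/eqP => zx; apply: no; exists x.
suff : v < z d by rewrite ltNge zd.
apply: (@cousin _ c d (fun x => v < z x) cd); last first.
  by rewrite lt_neqAle zc andbT eq_sym zv // lexx.
move=> t ctd; have zt := zv t ctd.
have [e e0 he] := ACz `|z t - v| ltac:(by rewrite normr_gt0 subr_eq0).
have near x y : c <= x -> x <= y -> y <= d -> y - x < e -> `|z y - z x| < `|z t - v|.
  move=> cx xy yd xye; have := he 1%N (fun _ => x) (fun _ => y).
  rewrite !big_ord1; apply => //.
  by move=> i j _ _ _; rewrite (ord1 i) (ord1 j).
exists e => // x y cx xt ty yd xye vx.
have h1 := near x t cx xt ltac:(lra) ltac:(lra).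
have h2 := near t y ltac:(lra) ty yd ltac:(lra).
have vt : v < z t.
  rewrite lt_neqAle eq_sym zt leNgt; apply/negP => ztv.
  move: h1; rewrite [X in _ < X]ltr0_norm; last by rewrite subr_lt0.
  by rewrite ltr_distl; lra.
move: h2; rewrite [X in _ < X]gtr0_norm; last by rewrite subr_gt0.
by rewrite ltr_distl; lra.
Qed.

Section Descent.
Context {R : realType}.
Variables (theta : R) (n : nat) (h : R -> R).
Local Notation m := n.+2.
Local Notation root := (root n.+1).
Local Notation mu := (leb R).
Hypothesis th1 : 1 < theta.
Hypothesis h_gt0 : forall t, 0 < t -> 0 < h t.
Hypothesis h_cont : {within `]0, +oo[, continuous h}.

Lemma h_min (x y : R) : 0 < x -> x <= y ->
  exists2 c, x <= c <= y & forall t, x <= t <= y -> h c <= h t.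
Proof.
move=> x0 xy; have hc : {within `[x, y], continuous h}.
  apply: continuous_subspaceW h_cont => t; rewrite /= !in_itv /= andbT => /andP[xt _].
  exact: lt_le_trans xt.
have [c] := EVT_min xy hc; rewrite in_itv /= => cxy hmin; exists c => //.
Qed.

Lemma gfun_le (t y : R) : 0 < t -> t / theta < y < theta * t -> gfun theta h t <= h y.
Proof.
move=> t0 ty; apply: ge_inf; last by exists y => //=; rewrite in_itv.
exists 0 => z [s]; rewrite /= in_itv /= => /andP[ts _] <-; apply/ltW/h_gt0.
by apply: lt_trans ts; rewrite divr_gt0 // (lt_trans ltr01).
Qed.

(** The interval of the infimum lies in a compact subset of the positive half-line, on which [h] has
    a positive minimum. *)
Lemma gfun_gt0 (t : R) : 0 < t -> 0 < gfun theta h t.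
Proof.
move=> t0; have th0 : 0 < theta := lt_trans ltr01 th1.
have tt : t / theta < t by rewrite ltr_pdivrMr // ltr_pMr.
have tt' : t < theta * t by rewrite ltr_pMl.
have t'0 : 0 < t / theta by rewrite divr_gt0.
have [c /andP[c1 c2] hc] := h_min t'0 (ltW (lt_trans tt tt')).
apply: (lt_le_trans (h_gt0 (lt_le_trans t'0 c1))); apply: lb_le_inf.
  by exists (h t), t => //=; rewrite in_itv /= tt tt'.
move=> z [s]; rewrite /= in_itv /= => /andP[s1 s2] <-.
by apply: hc; rewrite (ltW s1) (ltW s2).
Qed.

Local Notation tt j := (theta^-1 ^+ j).

(** For [t] between [theta^-(j+1)] and [theta^-j], the point where [h] equals [gam j] lies in the
    interval defining [g t], so [g t <= gam j]. As [t^(1/m-1)] decreases, the integrand is at least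
    [c j] there, and [c j] times the length of the interval is the [j]-th term times
    [1 - 1/theta]. *)
Lemma blocks_sum_bounded (gam : nat -> R) : (forall j, 0 < gam j) ->
  (forall j, exists2 c, tt j.+1 <= c <= tt j & gam j = h c) ->
  (\int[mu]_(t in `]0%R, 1%R[)
     (gfun theta h t `^ (- m%:R^-1) * t `^ (m%:R^-1 - 1))%R%:E < +oo)%E ->
  exists2 M, 0 <= M & forall k, \sum_(j < k) root (tt j / gam j) <= M.
Proof.
move=> gam0 gamh Ifin; have th0 : 0 < theta := lt_trans ltr01 th1.
have iv0 : 0 < theta^-1 by rewrite invr_gt0.
have iv1 : theta^-1 < 1 by rewrite invf_lt1.
have t0 j : 0 < tt j by rewrite exprn_gt0.
have tS j : tt j.+1 < tt j by rewrite exprSr gtr_pMr.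
have tmono i j : (i <= j)%N -> tt j <= tt i.
  by move=> ij; rewrite ler_wiXn2l ?ltW.
set G := fun t => _ in Ifin.
set I := integral _ _ _ in Ifin.
have I0 : (0 <= I)%E by apply: integral_ge0 => t _; rewrite lee_fin mulr_ge0 ?powR_ge0.
have IE : I = (fine I)%:E by rewrite fineK // ge0_fin_numE.
have I0' : 0 <= fine I by rewrite -lee_fin -IE.
pose k1 := 1 - theta^-1; have k10 : 0 < k1 by rewrite subr_gt0.
exists (fine I / k1); first by rewrite divr_ge0 // ltW.
move=> k; rewrite ler_pdivlMr // mulr_suml -lee_fin -IE.
pose c j := (root (gam j))^-1 * (root (tt j) / tt j).
have rg j : 0 < root (gam j) by rewrite powR_gt0.
apply: le_trans (integral_ge_steps (c := c) (x := fun j => tt j.+1) (y := fun j => tt j)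
  (k := k) _ _ _ _ _ _).
- rewrite lee_fin le_eqVlt; apply/orP; left; apply/eqP; apply: eq_bigr => j _.
  rewrite root_div ?(ltW (t0 j)) // /c exprSr /k1; field.
  by rewrite !gt_eqF.
- by move=> t _; rewrite mulr_ge0 ?powR_ge0.
- by move=> j; rewrite /c mulr_ge0 ?invr_ge0 ?divr_ge0 ?root_ge0 // ltW.
- by move=> j; exact: ltW.
- move=> j _ t; rewrite /= !in_itv /= => /andP[h1 h2].
  apply/andP; split; first exact: lt_trans (t0 _) h1.
  exact: (lt_le_trans h2 (tmono 0%N j (leq0n j))).
- move=> j t _ /andP[h1 h2].
  have tpos : 0 < t by exact: lt_trans h1.
  have [c' /andP[c1 c2] ghE] := gamh j.
  have gle : gfun theta h t <= gam j.
    rewrite ghE; apply: gfun_le => //; apply/andP; split.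
      apply: lt_le_trans c1; rewrite exprSr ltr_pM2r //.
    apply: le_lt_trans c2 _; rewrite -ltr_pdivrMl //.
    by rewrite mulrC -exprSr.
  have g0 := gfun_gt0 tpos.
  rewrite /G /c; apply: ler_pM.
  + by rewrite invr_ge0 ltW.
  + by rewrite divr_ge0 ?root_ge0 // ltW.
  + rewrite powRN lef_pV2 ?posrE ?powR_gt0 //.
    by rewrite (le_rootP n.+1) // ltW.
  + rewrite powRB ?powRr1 ?(ltW tpos) //; last by apply/implyP => _; rewrite gt_eqF.
    rewrite -/(root t) !root_divx // lef_pV2 ?posrE ?exprn_gt0 ?root_gt0 //.
    by apply: lerXn2r; rewrite ?nnegrE ?root_ge0 // le_rootP ltW.
- move=> i j _ _ [t [/=]]; rewrite !in_itv /= => /andP[h1 h2] /andP[h3 h4].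
  have [ij|ji|//] := ltngtP i j.
    by have := lt_trans h1 (lt_le_trans h4 (tmono _ _ ij)); rewrite ltxx.
  by have := lt_trans h3 (lt_le_trans h2 (tmono _ _ ji)); rewrite ltxx.
Qed.

Lemma descent_bounded (R0 G : R) (F w : R -> R) : 0 <= G ->
  (forall r, R0 <= r -> 0 < w r) ->
  (forall x y, R0 <= x -> x <= y -> w y <= w x) ->
  (forall x y, R0 <= x -> x <= y -> abs_continuous x y w) ->
  (forall r r' gam T, R0 <= r -> r <= r' -> 0 < gam ->
    (forall t, r <= t <= r' -> gam <= h (w t)) -> w r <= T ->
    root (F r') <= root (F r) + G * root (T / gam)) ->
  (\int[mu]_(t in `]0%R, 1%R[)
     (gfun theta h t `^ (- m%:R^-1) * t `^ (m%:R^-1 - 1))%R%:E < +oo)%E ->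
  exists M, forall r, R0 <= r -> root (F r) <= M.
Proof.
move=> G0 w0 w_homo w_ac block Ifin; have th0 : 0 < theta := lt_trans ltr01 th1.
have iv0 : 0 < theta^-1 by rewrite invr_gt0.
have t0 j : 0 < tt j by rewrite exprn_gt0.
have tS j : tt j.+1 <= tt j by rewrite exprSr ger_pMr // invf_le1 // ltW.
have /choice[c hc] : forall j, exists c, tt j.+1 <= c <= tt j /\
    forall t, tt j.+1 <= t <= tt j -> h c <= h t.
  by move=> j; have [c h1 h2] := h_min (t0 j.+1) (tS j); exists c.
have gam0 j : 0 < h (c j).
  by apply: h_gt0; case: (hc j) => /andP[h1 _] _; exact: lt_le_trans h1.
have [S S0 hS] : exists2 M, 0 <= M & forall k, \sum_(j < k) root (tt j / h (c j)) <= M.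
  apply: (blocks_sum_bounded gam0) => // j; exists (c j) => //.
  by case: (hc j).
(* The values of [w] above 1, if any, form a separate initial block, whose cost is contained in
   [M0]. *)
have w1 : 1 <= Num.max 1 (w R0) by rewrite le_max lexx.
have [c0 /andP[c01 _] hc0] := h_min ltr01 w1.
have gc0 : 0 < h c0 by apply: h_gt0; exact: lt_le_trans c01.
pose M0 := root (F R0) + G * root (w R0 / h c0).
have claim k : forall r, R0 <= r -> tt k <= w r ->
    root (F r) <= M0 + G * \sum_(j < k) root (tt j / h (c j)).
  elim: k => [|k IH] r R0r wr.
    rewrite big_ord0 mulr0 addr0; apply: block => // t /andP[R0t tr].
    apply: hc0; rewrite le_max (w_homo _ _ (lexx _) R0t) orbT andbT.
    by rewrite -(expr0 theta^-1) (le_trans wr) // w_homo.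
  have sum0 : 0 <= \sum_(j < k) root (tt j / h (c j)).
    by apply: sumr_ge0 => j _; exact: root_ge0.
  have last0 := root_ge0 n.+1 (tt k / h (c k)).
  rewrite big_ord_recr /= mulrDr addrA.
  have [wk|wk] := leP (tt k) (w r).
    by apply: le_trans (IH r R0r wk) _; rewrite lerDl mulr_ge0.
  have step r1 : R0 <= r1 -> r1 <= r -> w r1 <= tt k ->
      root (F r) <= root (F r1) + G * root (tt k / h (c k)).
    move=> R0r1 r1r wr1; apply: block => // t /andP[r1t tr].
    case: (hc k) => _; apply; apply/andP; split.
      by apply: le_trans wr _; apply: w_homo => //; exact: le_trans r1t.
    by apply: le_trans wr1; exact: w_homo.
  (* If [w] starts below this level, the block begins at [R0]; otherwise it begins where [w] crosses
     the level. *)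
  have [w0k|w0k] := leP (w R0) (tt k).
    apply: le_trans (step R0 (lexx _) R0r w0k) _; rewrite lerD2r /M0 -addrA lerDl.
    by rewrite addr_ge0 // mulr_ge0 ?root_ge0.
  have [r1 /andP[R0r1 r1r] wr1] := abs_continuous_ivt R0r (w_ac _ _ (lexx _) R0r)
    (ltW wk) (ltW w0k).
  apply: le_trans (step r1 R0r1 r1r _) _; first by rewrite wr1.
  by rewrite lerD2r; apply: IH => //; rewrite wr1.
exists (M0 + G * S) => r R0r.
have [k hk] := powers_unbounded 1 th1 (w0 r R0r).
have wk : tt k.+1 <= w r.
  by rewrite exprVn -[X in X <= _]mul1r ler_pdivrMr ?exprn_gt0 // mulrC.
apply: le_trans (claim k.+1 r R0r wk) _.
by rewrite lerD2l ler_wpM2l.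
Qed.

End Descent.

Lemma limf_esup_pinfty_bound {R : realType} (k : R -> R) :
  (limf_esup (fun r : R => (k r)%:E) (+oo%R : set_system R) < +oo)%E ->
  exists C A : R, forall r, A < r -> k r <= C.
Proof.
move=> /ereal_inf_lt[_ [V [A [_ AV]] <-]] hV.
have [C hC] : exists C : R, (ereal_sup [set (k r)%:E | r in V] <= C%:E)%E.
  case: (ereal_sup _) hV => [C| |] // _; first by exists C.
  by exists 0; rewrite leNye.
exists C, A => r Ar; rewrite -lee_fin; apply: le_trans hC.
by apply: ereal_sup_ubound; exists r => //; exact: AV.
Qed.

Theorem theorem2p2 (R : realType) (m : nat) (a theta sigma : R)
  (Q : R -> 'rV[R]_m -> R) (q : R -> R) (b : nat -> R -> R) (h : R -> R) :
  (2 <= m)%N -> 0 < a -> 1 < theta -> 1 < sigma ->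
  Caratheodory_loc a Q ->
  (forall r, a <= r -> 0 <= q r) ->
  Linfty_loc a q ->
  (forall i, (1 <= i < m)%N -> forall r, a <= r -> 0 <= b i r) ->
  (forall i, (1 <= i < m)%N -> Linfty_loc a (b i)) ->
  (forall t, 0 < t -> 0 < h t) ->
  {within `]0, +oo[, continuous h} ->
  (forall (r : R) (t : nat -> R), a <= r -> 0 < t 0%N ->
     (forall i, (1 <= i < m)%N -> 0 <= (-1) ^+ i * t i) ->
     q r * h (t 0%N) - \sum_(1 <= i < m) b i r * `|t i|
       <= (-1) ^+ m * Q r (\row_(i < m) t i)) ->
  let g := gfun theta h in
  let f := ffun_coef a sigma m q b in
  (\int[leb R]_(t in `]0%R, 1%R[)
     (g t `^ (- m%:R^-1) * t `^ (m%:R^-1 - 1))%R%:E < +oo)%E ->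
  (\int[leb R]_(xi in `[a, +oo[) (xi ^+ m.-1 * f xi)%R%:E = +oo)%E ->
  (limf_esup (fun r : R =>
     (r ^+ m * f r / \int[leb R]_(xi in `[a, r]) (xi ^+ m.-1 * f xi))%:E)
     (+oo%R : set_system R) < +oo)%E ->
  forall w : R -> R, is_solution a Q w -> nontrivial a w ->
    singular_first_kind a w.
Proof.
case: m Q => [|[|n]] // Q _ a0 th1 s1 _ q0 qL b0 bL h0 hcont hQ.
move=> g f Ifin Foo limsup w [der ac eqn sign] wnt; split => //.
set A : set R := `[a, +oo[%classic.
pose u i r := (-1) ^+ i * deriven_on A i w r.
have u0E r : u 0 r = w r by rewrite /u expr0 mul1r.
have u_ge0 i r : (i < n.+2)%N -> a <= r -> 0 <= u i r by exact: sign.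
have u_ac i : (i < n.+2)%N -> loc_abs_continuous a (u i).
  by move=> im c d ac' cd; apply: abs_continuousZ; exact: ac.
have u_straddle i : (i < n.+1)%N -> forall c d t, a <= c -> c <= t <= d ->
    straddle c d (u i) (- u i.+1 t) t.
  move=> im c d t ac' /[dup] ctd /andP[ct _].
  have -> : - u i.+1 t = (-1) ^+ i * derive_on A (deriven_on A i w) t.
    by rewrite /u exprS mulN1r mulNr opprK.
  by apply: derive_on_straddle => //; apply: der => //; exact: le_trans ct.
have w_homo x y : a <= x -> x <= y -> u 0 y <= u 0 x.
  exact: (u_homo u_ge0 u_ac u_straddle (ltn0Sn n)).
have wE r : a <= r -> (w r = 0 \/ 0 < w r).
  move=> ar; have := u_ge0 0%N r isT ar.
  by rewrite u0E le_eqVlt => /predU1P[<-|]; [left|right].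
(* A zero of [w] persists, since [w] is nonnegative and nonincreasing; only an everywhere positive
   [w] has to be refuted. *)
have [w_pos|] := pselect (forall r, a <= r -> 0 < w r); last first.
  move=> /existsNP[r0] /not_implyP[ar0 wr0].
  have {}wr0 : w r0 = 0 by case: (wE r0 ar0).
  exists r0; split; first exact: num_real.
  move=> r r0r; have ar : a <= r by exact: le_trans (ltW r0r).
  have := w_homo _ _ ar0 (ltW r0r).
  have := u_ge0 0%N r isT ar; rewrite !u0E wr0 => h1 h2.
  by apply/eqP; rewrite eq_le h1 h2.
exfalso.
have u_last : {ae leb R, forall t, a <= t -> forall c d, a <= c -> c <= t <= d ->
    straddle c d (u n.+1) (- (q t * h (u 0 t)) + \sum_(1 <= i < n.+2) b i t * u i t) t}.
  move: eqn; apply: ae_mono => t ht at_ c d ac' ctd; have [dt Et] := ht at_.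
  apply: straddle_le (derive_on_straddle _ ac' ctd dt).
  have -> : derive_on A (deriven_on A n.+1 w) t = Q t (jet a n.+2 w t) by exact: Et.
  have hi i : (1 <= i < n.+2)%N -> 0 <= (-1) ^+ i * deriven_on A i w t.
    by move=> /andP[_ im]; exact: sign.
  have := hQ t (fun i => deriven_on A i w t) at_ (w_pos t at_) hi.
  rewrite exprS mulN1r mulNr -/(jet a n.+2 w t) u0E /=.
  set X := _ * Q t _.
  have -> : \sum_(1 <= i < n.+2) b i t * `|deriven_on A i w t| =
            \sum_(1 <= i < n.+2) b i t * u i t.
    rewrite big_nat_cond [RHS]big_nat_cond; apply: eq_bigr => i; rewrite andbT => him.
    congr (_ * _); rewrite -[RHS]ger0_norm; last exact: hi.
    by rewrite /u normrM normrX normrN1 expr1n mul1r.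
  by lra.
pose phi := fun x : R => x ^+ n.+1 * f x.
have phi_ge0 := weight_ge0 a0 s1 q0 b0 bL.
have mphi := lmeasurable_weight a0 s1 qL b0 bL.
have bphi := weight_bounded a0 s1 q0 qL b0 bL.
pose F := primitive a phi.
have F_homo x y : a <= x -> x <= y -> F x <= F y by exact: primitive_homo.
have [C [A0 hC]] := limf_esup_pinfty_bound limsup.
have [r1 ar1 Fr1] := primitive_unbounded phi_ge0 mphi bphi Foo 0.
(* Beyond [R0] the quotient bound is available and [F] is positive; the maximum with 1 makes the
   constant positive. *)
pose R0 := Num.max r1 (A0 + 1); pose C' := Num.max C 1.
have r1R0 : r1 <= R0 by rewrite le_max lexx.
have A0R0 : A0 + 1 <= R0 by rewrite le_max lexx orbT.
have aR0 : a <= R0 by exact: le_trans r1R0.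
have FR0 : 0 < F R0 by exact: lt_le_trans Fr1 (F_homo _ _ ar1 r1R0).
have C'0 : 0 < C' by rewrite lt_max ltr01 orbT.
have F_growth x y : R0 <= x -> x <= y -> F y - F x <= C' * F y * (y - x) / x.
  move=> R0x xy; have ax : a <= x by exact: le_trans R0x.
  have x0 : 0 < x by exact: lt_le_trans ax.
  rewrite mulrAC; apply: (primitive_sub_le phi_ge0 mphi bphi ax xy).
  apply: nearW => t /andP[xt ty].
  have t0 : 0 < t by exact: lt_le_trans xt.
  have at_ : a <= t by exact: le_trans xt.
  have Ft : 0 < F t by apply: lt_le_trans FR0 (F_homo _ _ aR0 (le_trans R0x xt)).
  have := hC t ltac:(lra); rewrite -/(F t) ler_pdivrMr // => h1.
  rewrite ler_pdivlMr //.
  have h2 : t ^+ n.+1 * f t * t <= C' * F y.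
    rewrite mulrAC -exprSr; apply: le_trans h1 _.
    apply: (@le_trans _ _ (C' * F t)); first by rewrite ler_pM2r // le_max lexx.
    by rewrite ler_pM2l // F_homo.
  apply: le_trans h2; rewrite ler_wpM2l //; exact: phi_ge0.
(* As [delta <= 1], [(1 + delta)^2 <= 1 + 3 * delta], which is less than [sigma]. *)
pose delta := Num.min 1 ((sigma - 1) / 4).
have d0 : 0 < delta by rewrite lt_min ltr01 divr_gt0 // subr_gt0.
have d1 : delta <= 1 by rewrite ge_min lexx.
have d2 : delta <= (sigma - 1) / 4 by rewrite ge_min lexx orbT.
pose lambda := 1 + delta.
have l1 : 1 < lambda by rewrite ltrDl.
have l2 : lambda <= 2 by rewrite /lambda; lra.
have ls : lambda ^+ 2 < sigma by rewrite /lambda; nra.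
have step := interval_estimate a0 s1 q0 qL b0 bL u_ge0 u_ac u_straddle u_last.
have block r r' gam T : R0 <= r -> r <= r' -> 0 < gam ->
    (forall t, r <= t <= r' -> gam <= h (u 0 t)) -> u 0 r <= T ->
    root n.+1 (F r') <= root n.+1 (F r) + growth_const lambda C' n * root n.+1 (T / gam).
  move=> R0r rr' gam0 hgam uT.
  apply: (@block_growth _ a sigma lambda C' R0 n F (fun t => h (u 0 t)) (u 0)) => //.
  by apply: u_ge0 => //; apply: le_trans rr'; exact: le_trans R0r.
have [M hM] : exists M, forall r, R0 <= r -> root n.+1 (F r) <= M.
  apply: (descent_bounded th1 h0 hcont (growth_const_ge0 _ _ _) _ _ _ block Ifin).
  - by move=> r R0r; rewrite u0E; apply: w_pos; exact: le_trans R0r.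
  - by move=> x y R0x; apply: w_homo; exact: le_trans R0x.
  - by move=> x y R0x xy; apply: u_ac => //; exact: le_trans R0x.
pose M' := Num.max M 0.
have [r2 ar2 Fr2] := primitive_unbounded phi_ge0 mphi bphi Foo (M' ^+ n.+2).
pose r3 := Num.max r2 R0.
have R0r3 : R0 <= r3 by rewrite le_max lexx orbT.
have Fr3 : M' ^+ n.+2 < F r3.
  by apply: lt_le_trans Fr2 (F_homo _ _ ar2 _); rewrite le_max lexx.
have F3 : 0 <= F r3 by apply: le_trans (ltW FR0) (F_homo _ _ aR0 R0r3).
suff : F r3 <= M' ^+ n.+2 by rewrite leNgt Fr3.
rewrite -[X in X <= _](@rootK _ n.+1) //; apply: lerXn2r; rewrite ?nnegrE ?root_ge0 //.
  by rewrite le_max lexx orbT.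
by apply: le_trans (hM _ R0r3) _; rewrite le_max lexx.
Qed.
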